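(* Let $m>0$, $\Omega>0$, $S>0$, let $\mathcal{C}\subset\mathbb{C}$ be a finite nonempty set (the constellation), let $\sigma_\Theta^2=\sigma_\Theta^2(m)$, and put $\beta=1+\frac{m}{\Omega}$. For $x\in\mathcal{C}$ and $y\in\mathbb{C}$ let $f_G(y|x)$ be the Gaussian-phase likelihood $$f_G(y|x)=\int_{-\infty}^{\infty}\int_0^\infty \frac1\pi \exp\left(-|y-\sqrt{S}x-ae^{j\theta}|^2\right) f_A(a)\,\frac{1}{\sqrt{2\pi}\,\sigma_\Theta}e^{-(\theta-\pi)^2/(2\sigma_\Theta^2)}\,da\,d\theta .$$ Then for every $y\in\mathbb{C}$ the maximum-likelihood rule $\hat x_{\text{ML-G}}(y)=\operatorname{argmax}_{x\in\mathcal{C}} f_G(y|x)$ is given by $$\hat x_{\text{ML-G}}(y)=\operatorname*{argmin}_{x\in\mathcal{C}}\; \left\{ r^2-\ln \mathcal{S}(r,\phi)\right\},$$ (the set of maximizers of the former equals the set of minimizers of the latter), where $r=|y-\sqrt{S}x|$, $\phi=\arg(y-\sqrt{S}x)$, $$\mathcal{S}(r,\phi)=I_{0,m}(r)+\sum_{k=1}^\infty w_k(\phi)\,I_{k,m}(r),$$ $$I_{k,m}(r)=\frac{\Gamma\left(m+\frac k2\right)}{2\beta^{m+\frac k2}\,k!}\,r^k\,{}_1F_1\left(m+\frac k2;k+1;\frac{r^2}{\beta}\right),\qquad w_k(\phi)=(-1)^k\,2e^{-\frac12\sigma_\Theta^2k^2}\cos(k\phi).$$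
   Context: The received signal is $Y=\sqrt{S}X+I+N$, where $X\in\mathcal{C}$ is the transmitted symbol (the constellation has unit average energy), $S$ is the transmit power, $N\sim\mathcal{CN}(0,1)$ is circularly symmetric complex Gaussian noise, and $I=Ae^{j\Theta}$ is interference ($j$ is the imaginary unit), with $X$, $A$, $\Theta$, $N$ independent. The envelope $A$ is Nakagami-$m$ with shape $m$ and spread $\Omega$, with density $$f_A(a)=\frac{2m^m}{\Gamma(m)\Omega^m}a^{2m-1}e^{-\frac m\Omega a^2},\quad a\ge 0.$$ The phase $\Theta$ has the Nakagami-$m$ phase density $|\sin2\theta|^{m-1}/(2\sqrt\pi\,C(m))$ on $[0,2\pi]$ with $C(m)=\Gamma(m/2)/\Gamma((m+1)/2)$. In the ML-G (maximum-likelihood Gaussian-phase approximate) rule, this phase law is replaced by the Gaussian law on $\mathbb{R}$ with mean $\pi$ and variance $$\sigma_\Theta^2(m)=\frac{\pi^2}{4}+\frac{\int_0^\pi t^2\sin^{m-1}t\,dt}{4\sqrt\pi\,C(m)}.$$ ${}_1F_1$ is the confluent hypergeometric function of the first kind, and $\arg 0$ may be taken to be any real number. *)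

(* Defs.v *)
From HB Require Import structures.
From mathcomp Require Export all_boot all_order all_algebra.
From mathcomp Require Export all_classical all_reals all_analysis.
From mathcomp Require Export complex.

Set Implicit Arguments.
Unset Strict Implicit.
Unset Printing Implicit Defensive.

Import Order.TTheory GRing.Theory Num.Theory.
Import numFieldNormedType.Exports.

Local Open Scope classical_set_scope.
Local Open Scope ring_scope.
Local Open Scope complex_scope.

Definition argmax (d : Order.disp_t) (V : porderType d) (T : Type)
    (C : set T) (f : T -> V) : set T :=
  [set x | C x /\ forall x', C x' -> (f x' <= f x)%O].

Definition argmin (d : Order.disp_t) (V : porderType d) (T : Type)
    (C : set T) (f : T -> V) : set T :=
  [set x | C x /\ forall x', C x' -> (f x <= f x')%O].

Section definitions.
Context {R : realType}.
Implicit Types (a m Omega S r phi theta : R) (x y z : R[i]) (k : nat).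

Local Notation mu := (@lebesgue_measure R).

(* The library's norm on R[i] takes its values in R[i]; this one is R-valued. *)
Definition cabs z : R := ComplexField.Normc.normc z.

Definition cexpi theta : R[i] := cos theta +i* sin theta.

(* Any choice of argument is allowed: principal or not, and arbitrary at 0. *)
Definition is_arg (arg : R[i] -> R) : Prop :=
  forall z, z = (cabs z)%:C * cexpi (arg z).

(* Euler's integral; it is only used at arguments s > 0. *)
Definition Gamma (s : R) : R :=
  \int[mu]_(t in `[0, +oo[) (t `^ (s - 1) * expR (- t)).

Definition pochhammer (a : R) (n : nat) : R := \prod_(i < n) (a + i%:R).

Definition hyp1F1 (a b z : R) : R :=
  limn (pseries (fun n => pochhammer a n / (pochhammer b n * n`!%:R)) z).

Definition nakagami_pdf m Omega a : R :=
  2 * m `^ m / (Gamma m * Omega `^ m) * a `^ (2 * m - 1)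
    * expR (- (m / Omega) * a ^+ 2).

Definition phase_const m : R := Gamma (m / 2) / Gamma ((m + 1) / 2).

(* The variance, about its mean pi, of the phase density
   |sin (2 t)|^(m-1) / (2 sqrt pi phase_const m) on [0, 2 pi]. *)
Definition phase_var m : R :=
  pi ^+ 2 / 4 +
  (\int[mu]_(t in `[0, pi]) (t ^+ 2 * (sin t) `^ (m - 1)))
    / (4 * Num.sqrt pi * phase_const m).

Definition phase_std m : R := Num.sqrt (phase_var m).

(* The density of the received y given x when the phase is Gaussian. *)
Definition likelihood_G m Omega S y x : \bar R :=
  (\int[mu]_theta \int[mu]_(a in `[0%R, +oo[)
    (pi^-1 * expR (- cabs (y - (Num.sqrt S)%:C * x - a%:C * cexpi theta) ^+ 2)
     * nakagami_pdf m Omega a * normal_pdf pi (phase_std m) theta)%:E)%E.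

Definition beta_coef m Omega : R := 1 + m / Omega.

Definition radial_term m Omega k r : R :=
  let s := m + k%:R / 2 in
  let beta := beta_coef m Omega in
  Gamma s / (2 * beta `^ s * k`!%:R) * r ^+ k
    * hyp1F1 s (k%:R + 1) (r ^+ 2 / beta).

Definition phase_weight m k phi : R :=
  (-1) ^+ k * (2 * expR (- (1 / 2) * phase_var m * k%:R ^+ 2)
    * cos (k%:R * phi)).

Definition metric_series m Omega r phi : R :=
  radial_term m Omega 0 r +
  limn (fun n =>
    \sum_(1 <= k < n) phase_weight m k phi * radial_term m Omega k r).

Lemma ex_is_arg : exists arg : R[i] -> R, is_arg arg.
Proof.
suff H z : exists t : R, z = (cabs z)%:C * cexpi t.
  by exists (fun z => projT1 (cid (H z))) => z; exact: projT2 (cid (H z)).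
case: z => u v; rewrite /cabs /cexpi /=; set n := Num.sqrt _.
have n2 : n ^+ 2 = u ^+ 2 + v ^+ 2 by rewrite sqr_sqrtr ?addr_ge0 ?sqr_ge0.
have n0 : 0 <= n by exact: sqrtr_ge0.
have [nE|nN] := eqVneq n 0.
  move: n2; rewrite nE expr0n /= => /esym/eqP.
  rewrite paddr_eq0 ?sqr_ge0 // !sqrf_eq0 => /andP[/eqP -> /eqP ->].
  by exists 0; apply/eqP; rewrite eq_complex /= !mul0r subrr addr0 !eqxx.
have c2 : (u / n) ^+ 2 + (v / n) ^+ 2 = 1.
  by rewrite !expr_div_n -mulrDl -n2 divff // expf_neq0.
have cB : -1 <= u / n <= 1.
  by rewrite -ler_norml -(@expr_le1 _ 2) // real_normK ?num_real // -c2 lerDl sqr_ge0.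
have sA : sin (acos (u / n)) = `|v / n|.
  by rewrite sin_acos // -c2 addrAC subrr add0r sqrtr_sqr.
have cA : cos (acos (u / n)) = u / n by rewrite acosK // in_itv.
have [v0|v0] := leP 0 v.
  exists (acos (u / n)); apply/eqP; rewrite eq_complex /= cA sA !mul0r subr0 addr0.
  by rewrite ger0_norm ?divr_ge0 // ![n * _]mulrC !divfK // !eqxx.
exists (- acos (u / n)); apply/eqP.
rewrite eq_complex /= cosN sinN cA sA !mul0r subr0 addr0.
by rewrite normrM ltr0_norm // ger0_norm ?invr_ge0 // mulNr opprK ![n * _]mulrC !divfK // !eqxx.
Qed.

End definitions.

(* Main.v *)
Require Import Defs.
From mathcomp Require Import measurable_realfun ring lra zify.
Import Order.TTheory GRing.Theory Num.Theory.
Import numFieldNormedType.Exports.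
Local Open Scope classical_set_scope.
Local Open Scope ring_scope.
Local Open Scope complex_scope.

Set Implicit Arguments.
Unset Strict Implicit.
Unset Printing Implicit Defensive.

(** Write [z = y - sqrt S x = r e^(j phi)].  Since
    [|z - a e^(j theta)|^2 = r^2 + a^2 - 2 a r cos (theta - phi)], the likelihood is
    a constant times [exp (- r^2)] times the Gaussian average over [theta] of
    [G (cos (theta - phi))], where [G u] is the integral of
    [a^(2m-1) exp (- beta a^2) exp (2 r u a)].  Expanding the last exponential in
    powers of [a] and integrating termwise gives
    [G u = sum_d r^d M_d (2 u)^d / d!] with [M_d] a Gamma-type moment.  Each
    [(2 cos psi)^d / d!] is a cosine polynomial whose coefficients are those of the
    modified Bessel functions, and the Gaussian mean of [cos (k (theta - phi))] is
    [(-1)^k exp (- sigma^2 k^2 / 2) cos (k phi)].  Exchanging the absolutely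
    convergent sums over [d] and [k] and resumming over [d = k + 2 n] produces the
    confluent hypergeometric functions: the average is the metric series.  It is
    positive, so [ln] turns the likelihood into the metric. *)

(** * Integrals over the open half-line *)

Section half_line.
Context {R : realType}.
Local Notation mu := (@lebesgue_measure R).

Lemma exhaust_itv0y (a b : R^nat) : nonincreasing_seq a -> (forall n, 0 < a n) ->
    a @ \oo --> 0 -> nondecreasing_seq b -> b @ \oo --> +oo ->
  \bigcup_n `[a n, b n]%classic = `]0, +oo[%classic.
Proof.
move=> na a0 ca nb cb; apply/seteqP; split => x /=.
  by move=> [n _]; rewrite /= !in_itv/= => /andP[ax _]; rewrite andbT (lt_le_trans (a0 n)).
rewrite in_itv/= andbT => x0.
have [n [? ?]] : exists n, a n <= x /\ x <= b n.
  near \oo => n; exists n; split; near: n.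
    by apply: (cvgr_le 0 ca).
  by apply/(cvgryPge b).1.
by exists n => //=; rewrite in_itv/=; apply/andP.
Unshelve. all: end_near. Qed.

(** Monotone convergence along compact intervals. The endpoints are arbitrary sequences because a
    change of variables also produces the images of a given exhaustion. *)
Lemma cvg_integral_itv0y (a b : R^nat) (f : R -> R) :
    nonincreasing_seq a -> (forall n, 0 < a n) -> a @ \oo --> 0 ->
    nondecreasing_seq b -> b @ \oo --> +oo ->
    measurable_fun `](0:R), +oo[ f -> (forall x : R, 0 < x -> 0 <= f x) ->
  (\int[mu]_(x in `[a n, b n]) (f x)%:E)%E @[n --> \oo] -->
  (\int[mu]_(x in `]0%R, +oo[) (f x)%:E)%E.
Proof.
move=> na a0 ca nb cb mf f0; rewrite -(exhaust_itv0y na a0 ca nb cb).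
have sub n : `[a n, b n] `<=` `]0, +oo[%classic.
  by move=> x /=; rewrite !in_itv/= andbT => /andP[+ _]; exact: lt_le_trans.
apply: ge0_nondecreasing_set_cvg_integral => //.
- move=> m n mn; apply/subsetPset => x /=; rewrite !in_itv/= => /andP[ax xb].
  by rewrite (le_trans (na _ _ mn)) ?(le_trans xb (nb _ _ mn)).
- by move=> n; apply/measurable_EFinP; apply: measurable_funS mf.
- by move=> n x /sub; rewrite /= in_itv/= andbT lee_fin; exact: f0.
Qed.

(* The factor 1/2 keeps the intervals nondegenerate at n = 0. *)
Definition expand_lo (n : nat) : R := n.+1%:R^-1 / 2.
Definition expand_hi (n : nat) : R := n.+1%:R.

Lemma expand_lo_gt0 n : 0 < expand_lo n.
Proof. by rewrite divr_gt0// invr_gt0. Qed.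

Lemma expand_lo_nonincreasing : nonincreasing_seq expand_lo.
Proof.
by move=> m n mn; rewrite ler_pM2r ?invr_gt0// lef_pV2 ?posrE ?ltr0n// ler_nat.
Qed.

Lemma cvg_expand_lo : expand_lo @ \oo --> 0.
Proof.
rewrite -[0](mul0r (2^-1)); apply: cvgMl; exact: cvg_harmonic.
Qed.

Lemma expand_hi_nondecreasing : nondecreasing_seq expand_hi.
Proof. by move=> m n mn; rewrite ler_nat ltnS. Qed.

Lemma cvg_expand_hi : expand_hi @ \oo --> +oo.
Proof. by rewrite /expand_hi (cvg_shiftS (fun n => n%:R : R)); exact: cvgr_idn. Qed.

Lemma expand_lo_hi n : expand_lo n < expand_hi n.
Proof.
apply: (@lt_le_trans _ _ 1); last by rewrite ler1n.
rewrite /expand_lo ltr_pdivrMr// mul1r (@le_lt_trans _ _ 1) ?ltr1n//.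
by rewrite invf_le1// ler1n.
Qed.

(* The fundamental theorem of calculus for an F vanishing at both ends of the
   half-line, cast as an equality in [\bar R] so that no integrability is needed. *)
Lemma integral_itv0y_eq_of_derive (F f1 f2 : R -> R) :
    (forall x : R, 0 < x -> is_derive x 1 F (f1 x - f2 x)) ->
    (forall x : R, 0 < x -> {for x, continuous f1}) ->
    (forall x : R, 0 < x -> {for x, continuous f2}) ->
    (forall x : R, 0 < x -> 0 <= f1 x) -> (forall x : R, 0 < x -> 0 <= f2 x) ->
    F x @[x --> (0:R)^'+] --> 0 -> F x @[x --> +oo] --> 0 ->
  (\int[mu]_(x in `]0%R, +oo[) (f1 x)%:E = \int[mu]_(x in `]0%R, +oo[) (f2 x)%:E)%E.
Proof.
move=> dF cf1 cf2 f10 f20 F0 Fy.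
have ci (f : R -> R) : (forall x : R, 0 < x -> {for x, continuous f}) ->
    forall n, {within `[expand_lo n, expand_hi n], continuous f}.
  move=> cf n; apply: (@continuous_in_subspaceT R R) => x; rewrite inE/= in_itv/= => /andP[x1 _].
  by apply: cf; exact: lt_le_trans (expand_lo_gt0 n) x1.
have ii (f : R -> R) : (forall x : R, 0 < x -> {for x, continuous f}) ->
    forall n, mu.-integrable `[expand_lo n, expand_hi n] (EFin \o f).
  by move=> cf n; apply: continuous_compact_integrable; [exact: segment_compact|exact: ci].
have mf (f : R -> R) : (forall x : R, 0 < x -> {for x, continuous f}) ->
    measurable_fun `](0:R), +oo[ f.
  move=> cf; apply: open_continuous_measurable_fun => // x; rewrite inE/= in_itv/= andbT.
  exact: cf.
have E n : (\int[mu]_(x in `[expand_lo n, expand_hi n]) (f1 x)%:E =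
    \int[mu]_(x in `[expand_lo n, expand_hi n]) (f2 x)%:E +
    (F (expand_hi n) - F (expand_lo n))%:E)%E.
  have cF (x : R) : 0 < x -> {for x, continuous F}.
    by move=> x0; apply/differentiable_continuous/derivable1_diffP; have [] := dF _ x0.
  have := @continuous_FTC2 _ (fun x => f1 x - f2 x) F _ _ (expand_lo_hi n).
  rewrite EFinB => <-.
  - under [X in (_ = _ + X)%E]eq_integral do rewrite EFinB.
    rewrite integralB//=; [|exact: ii..].
    by rewrite addeC subeK// integrable_fin_num//; exact: ii.
  - by apply: ci => x x0; apply: cvgB; [exact: cf1|exact: cf2].
  - split.
    + move=> x; rewrite in_itv/= => /andP[x1 _].
      by have [] := dF _ (lt_trans (expand_lo_gt0 n) x1).
    + by apply: cvg_at_right_filter; apply: cF; exact: expand_lo_gt0.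
    + apply: cvg_at_left_filter; apply: cF.
      exact: lt_trans (expand_lo_gt0 n) (expand_lo_hi n).
  - move=> x; rewrite in_itv/= => /andP[x1 _]; rewrite derive1E.
    by have [_ ->] := dF _ (lt_trans (expand_lo_gt0 n) x1).
have c (f : R -> R) : (forall x : R, 0 < x -> {for x, continuous f}) ->
    (forall x : R, 0 < x -> 0 <= f x) ->
    (\int[mu]_(x in `[expand_lo n, expand_hi n]) (f x)%:E)%E @[n --> \oo] -->
    (\int[mu]_(x in `]0%R, +oo[) (f x)%:E)%E.
  move=> cf f0; apply: cvg_integral_itv0y (mf f cf) f0.
  - exact: expand_lo_nonincreasing.
  - exact: expand_lo_gt0.
  - exact: cvg_expand_lo.
  - exact: expand_hi_nondecreasing.
  - exact: cvg_expand_hi.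
(* The truncated integrals of [f1] get a second limit: by [E] they differ from those of [f2] by a
   boundary term that tends to 0. As that limit is finite, the sum of limits is defined even when
   the integral of [f2] is infinite. *)
have cE : (\int[mu]_(x in `[expand_lo n, expand_hi n]) (f1 x)%:E)%E @[n --> \oo] -->
    (\int[mu]_(x in `]0%R, +oo[) (f2 x)%:E)%E; last first.
  exact: (cvg_unique (@ereal_hausdorff R) (c f1 cf1 f10) cE).
under eq_cvg do rewrite E.
rewrite -(adde0 (integral _ _ _)); apply: cvgeD; [by rewrite fin_num_adde_defl|exact: c|].
apply/cvg_EFin; first exact: nearW.
rewrite /= -(subrr 0); apply: (@cvgB _ R^o).
  exact: (cvg_comp _ _ cvg_expand_hi Fy).
apply: cvg_comp F0.
move=> A /= [e e0 eA]; near=> n; apply: eA; last exact: expand_lo_gt0.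
rewrite /= sub0r normrN gtr0_norm ?expand_lo_gt0//; near: n.
exact: (cvgr_lt 0 cvg_expand_lo).
Unshelve. all: end_near. Qed.

End half_line.

(** * Euler's Gamma integral and Gaussian moments *)

Section gamma.
Context {R : realType}.
Local Notation mu := (@lebesgue_measure R).
Implicit Types s t x : R.

Definition gamma_fun s t : R := t `^ (s - 1) * expR (- t).

Lemma gamma_fun_ge0 s t : 0 <= gamma_fun s t.
Proof. by rewrite mulr_ge0 ?powR_ge0 ?expR_ge0. Qed.

Lemma measurable_gamma_fun s : measurable_fun setT (gamma_fun s).
Proof.
apply: measurable_funM; first exact: measurable_powR.
by apply: measurableT_comp => //; exact: measurable_funN.
Qed.

Lemma measurable_EFin_gamma_fun (D : set R) s :
  measurable_fun D (fun t => (gamma_fun s t)%:E).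
Proof. by apply/measurable_EFinP; apply: measurable_funTS; exact: measurable_gamma_fun. Qed.

(** Integration by parts in differential form; it yields the functional equation of Gamma. *)
Lemma is_derive_powR_expRN s x : 0 < x ->
  is_derive x 1 (fun t : R => t `^ s * expR (- t))
    (s * gamma_fun s x - gamma_fun (s + 1) x).
Proof.
move=> x0.
have d2 : is_derive x 1 (fun t : R => expR (- t)) (- expR (- x)).
  rewrite -mulrN1; exact: (is_derive1_comp (is_derive_expR _) (is_deriveNid _ _)).
apply: (is_derive_eq (is_deriveM (is_derive1_powR s x0) d2)).
rewrite /gamma_fun addrK /GRing.scale/=; ring.
Qed.

Lemma continuous_gamma_fun s x : 0 < x -> {for x, continuous (gamma_fun s)}.
Proof.
move=> x0; apply/differentiable_continuous/derivable1_diffP.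
by have [] := is_derive_powR_expRN (s - 1) x0.
Qed.

Lemma powR_expRN_cvgy s : t `^ s * expR (- t) @[t --> +oo] --> (0 : R).
Proof.
pose n := Num.bound `|s|.
have sn : s <= n%:R by rewrite (le_trans (ler_norm s))// ltW// archi_boundP.
apply/cvgr0Pnorm_le => e e0; near=> t.
have t1 : 1 <= t by near: t; apply: nbhs_pinfty_ge; exact: num_real.
have te : n.+1`!%:R / e <= t by near: t; apply: nbhs_pinfty_ge; exact: num_real.
have t0 : 0 < t by exact: lt_le_trans t1.
have f0 : 0 < n.+1`!%:R :> R by rewrite ltr0n fact_gt0.
rewrite ger0_norm ?mulr_ge0 ?powR_ge0 ?expR_ge0// expRN ler_pdivrMr ?expR_gt0//.
have h : t ^+ n.+1 / n.+1`!%:R <= expR t.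
  by rewrite (le_trans _ (expR_ge1Dxn n (ltW t0)))// lerDr.
apply: (le_trans (ler_powR t1 sn)); rewrite (powR_mulrn _ (ltW t0)).
rewrite -(ler_pM2l t0) -exprS; move: h; rewrite ler_pdivrMr// => /le_trans; apply.
rewrite mulrC mulrCA mulrA; apply: ler_wpM2r; first exact: expR_ge0.
by rewrite mulrC -ler_pdivrMr.
Unshelve. all: end_near. Qed.

Lemma powR_expRN_cvg0 s : 0 < s -> t `^ s * expR (- t) @[t --> (0 : R)^'+] --> (0 : R).
Proof.
move=> s0.
have : t `^ s * expR (- t) @[t --> (0 : R)^'+] --> 0 * expR (- 0 : R).
  apply: cvgM; first exact: powR_cvg0.
  apply: cvg_at_right_filter; apply: continuous_comp; first exact: oppr_continuous.
  exact: continuous_expR.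
by rewrite mul0r.
Qed.

(** Kept in the extended reals because finiteness of these integrals is itself deduced from this
    recurrence. *)
Lemma integral_gamma_funS s : 0 < s ->
  (s%:E * \int[mu]_(t in `]0%R, +oo[) (gamma_fun s t)%:E =
   \int[mu]_(t in `]0%R, +oo[) (gamma_fun (s + 1) t)%:E)%E.
Proof.
move=> s0; rewrite -ge0_integralZl//=; last 3 first.
- exact: measurable_EFin_gamma_fun.
- by move=> t _; rewrite lee_fin gamma_fun_ge0.
- by rewrite lee_fin ltW.
under eq_integral do rewrite -EFinM.
apply: (integral_itv0y_eq_of_derive (@is_derive_powR_expRN s)).
- by move=> x x0; apply: cvgM; [exact: cvg_cst|exact: continuous_gamma_fun].
- by move=> x x0; exact: continuous_gamma_fun.
- by move=> x x0; rewrite mulr_ge0 ?gamma_fun_ge0// ltW.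
- by move=> x x0; exact: gamma_fun_ge0.
- exact: powR_expRN_cvg0.
- exact: powR_expRN_cvgy.
Qed.

Lemma integral_gamma_fun1 : (\int[mu]_(t in `]0%R, +oo[) (gamma_fun 1 t)%:E = 1)%E.
Proof.
rewrite integral_itv_obnd_cbnd; last first.
  exact: measurable_EFin_gamma_fun.
rewrite -(integral_exponential_pdf (ltr01 : 0 < 1 :> R)) integral_mkcond.
apply: eq_integral => t _; rewrite /exponential_pdf !patchE.
by case: ifP => //= _; rewrite /gamma_fun subrr powRr0 mul1r mul1r mulN1r.
Qed.

Lemma integral_gamma_fun_nat n :
  (\int[mu]_(t in `]0%R, +oo[) (gamma_fun n.+1%:R t)%:E < +oo)%E.
Proof.
elim: n => [|n IH]; first by rewrite integral_gamma_fun1 ltry.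
by rewrite -[n.+2]addn1 natrD -integral_gamma_funS ?ltr0n// lte_mul_pinfty.
Qed.

(** For exponents at least 1, the integrand is bounded by the sum of two integer cases: the first
    dominates on []0, 1]], the second beyond 1. The recurrence then brings finiteness down from
    [s + 1] to [s]. *)
Lemma integral_gamma_fun_lty s : 0 < s ->
  (\int[mu]_(t in `]0%R, +oo[) (gamma_fun s t)%:E < +oo)%E.
Proof.
suff ge1 u : 1 <= u -> (\int[mu]_(t in `]0%R, +oo[) (gamma_fun u t)%:E < +oo)%E.
  move=> s0; have : (\int[mu]_(t in `]0%R, +oo[) (gamma_fun (s + 1) t)%:E < +oo)%E.
    by apply: ge1; rewrite lerDr ltW.
  rewrite -integral_gamma_funS//; apply: contraTT; rewrite -!leNgt !leye_eq => /eqP ->.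
  by rewrite gt0_muley// lte_fin.
move=> u1; pose n := Num.bound u.
have un : u <= n.+1%:R.
  by rewrite ltW// (lt_le_trans (archi_boundP (le_trans ler01 u1)))// ler_nat.
apply: (@le_lt_trans _ _ (\int[mu]_(t in `]0%R, +oo[)
    ((gamma_fun 1 t)%:E + (gamma_fun n.+1%:R t)%:E))%E).
  apply: ge0_le_integral => //=.
  - by move=> t _; rewrite lee_fin gamma_fun_ge0.
  - exact: measurable_EFin_gamma_fun.
  - by apply: emeasurable_funD; exact: measurable_EFin_gamma_fun.
  move=> t; rewrite in_itv/= andbT => t0; rewrite -EFinD lee_fin /gamma_fun -mulrDl.
  rewrite ler_pM2r ?expR_gt0// subrr powRr0.
  have [t1|t1] := leP 1 t.
    by rewrite (le_trans (ler_powR t1 (lerB un (lexx 1))))// lerDr.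
  apply: (@le_trans _ _ (t `^ 0)); last by rewrite powRr0 lerDl powR_ge0.
  by apply: ger_powR; rewrite ?subr_ge0// t0 ltW.
rewrite ge0_integralD//=; try exact: measurable_EFin_gamma_fun; last 2 first.
- by move=> t _; rewrite lee_fin gamma_fun_ge0.
- by move=> t _; rewrite lee_fin gamma_fun_ge0.
by apply: lte_add_pinfty; [rewrite integral_gamma_fun1 ltry|exact: integral_gamma_fun_nat].
Qed.

Lemma integral_gamma_fun s : 0 < s ->
  (\int[mu]_(t in `]0%R, +oo[) (gamma_fun s t)%:E = (Gamma s)%:E)%E.
Proof.
move=> s0; rewrite /Gamma /Rintegral -integral_itv_obnd_cbnd; last first.
  exact: measurable_EFin_gamma_fun.
rewrite fineK// ge0_fin_numE ?integral_gamma_fun_lty//.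
by apply: integral_ge0 => t _; rewrite lee_fin gamma_fun_ge0.
Qed.

Lemma GammaS s : 0 < s -> Gamma (s + 1) = s * Gamma s.
Proof.
move=> s0; apply: EFin_inj.
by rewrite EFinM -!integral_gamma_fun ?ltr_wpDr// integral_gamma_funS.
Qed.

Lemma Gamma_ge0 s : 0 <= Gamma s.
Proof. by apply: Rintegral_ge0 => t _; exact: gamma_fun_ge0. Qed.

Lemma Gamma_gt0 s : 0 < s -> 0 < Gamma s.
Proof.
(* A lower bound of the integrand on [[1, 2]], an interval of length one: the power of [t] is
   monotone there, hence at least its smaller endpoint value. *)
move=> s0; pose c := Num.min 1 (2 `^ (s - 1)) * expR (- 2) : R.
have c0 : 0 < c by rewrite mulr_gt0 ?expR_gt0// lt_min ltr01 powR_gt0.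
apply: (lt_le_trans c0); rewrite -lee_fin -integral_gamma_fun//.
apply: (@le_trans _ _ (\int[mu]_(t in `[1%R, 2%R]) (cst c%:E t))%E).
  rewrite integral_cst//= lebesgue_measure_itv/= lte_fin ltr1n -EFinB -EFinM lee_fin.
  by rewrite -[leLHS]mulr1 ler_pM2l//; lra.
apply: (@le_trans _ _ (\int[mu]_(t in `[1%R, 2%R]) (gamma_fun s t)%:E)%E).
  apply: ge0_le_integral => //=.
  - by move=> t _; rewrite lee_fin ltW.
  - exact: measurable_EFin_gamma_fun.
  move=> t; rewrite in_itv/= => /andP[t1 t2]; rewrite lee_fin.
  rewrite ler_pM ?expR_ge0 ?ler_expR ?lerN2//.
  rewrite ge_min; have [s1|s1] := leP 1 s.
    by have /= := ler_powR t1 (_ : 0 <= s - 1); rewrite powRr0 subr_ge0 => ->.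
  apply/orP; right; have -> : s - 1 = - (1 - s) by rewrite opprB.
  have t0 : 0 < t := lt_le_trans ltr01 t1.
  rewrite !powRN lef_pV2 ?posrE ?powR_gt0//.
  by apply: ge0_ler_powR; rewrite ?nnegrE ?subr_ge0//; exact: ltW.
apply: ge0_subset_integral => //=.
- exact: measurable_EFin_gamma_fun.
- by move=> t _; rewrite lee_fin gamma_fun_ge0.
- by move=> t /=; rewrite !in_itv/= andbT => /andP[t1 _]; exact: lt_le_trans t1.
Qed.

Lemma Gamma_addn s n : 0 < s -> Gamma (s + n%:R) = Gamma s * pochhammer s n.
Proof.
move=> s0; elim: n => [|n IH]; first by rewrite addr0 /pochhammer big_ord0 mulr1.
rewrite -addn1 natrD addrA GammaS ?ltr_wpDr// IH /pochhammer addn1 big_ord_recr/=.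
ring.
Qed.

End gamma.

Section gaussian_moments.
Context {R : realType}.
Local Notation mu := (@lebesgue_measure R).
Implicit Types s b a : R.

(** The exponent follows the Nakagami density of shape [s], so that a factor [a ^+ d] shifts [s] by
    [d%:R / 2]. At [s = 1 / 2] the power disappears and a plain Gaussian remains. *)
Definition gmom_fun s b a : R := a `^ (2 * s - 1) * expR (- (b * a ^+ 2)).

Definition gmom s b : R := Gamma s / (2 * b `^ s).

Lemma gmom_fun_ge0 s b a : 0 <= gmom_fun s b a.
Proof. by rewrite mulr_ge0 ?powR_ge0 ?expR_ge0. Qed.

Lemma gmom_gt0 s b : 0 < s -> 0 < b -> 0 < gmom s b.
Proof. by move=> s0 b0; rewrite divr_gt0 ?Gamma_gt0// mulr_gt0// powR_gt0. Qed.

Lemma measurable_gmom_fun (D : set R) s b : measurable_fun D (gmom_fun s b).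
Proof.
apply: measurable_funTS; apply: measurable_funM; first exact: measurable_powR.
apply: measurableT_comp => //; apply: measurable_funN.
by apply: measurable_funM => //; exact: measurable_funX.
Qed.

Lemma gamma_fun_subst s b a : 0 < b -> 0 < a ->
  gamma_fun s (b * a ^+ 2) * (2 * b * a) = 2 * b `^ s * gmom_fun s b a.
Proof.
move=> b0 a0; rewrite /gamma_fun /gmom_fun powRM ?ltW ?exprn_gt0//.
rewrite -(powR_mulrn 2 (ltW a0)) -powRrM.
have powRS c e : 0 < c -> c `^ (e + 1) = c `^ e * c.
  by move=> c0; rewrite powRD ?(gt_eqF c0) ?implybT// powRr1// ltW.
have -> : 2 * s - 1 = 2 * (s - 1) + 1 by ring.
have -> : b `^ s = b `^ (s - 1) * b by rewrite -powRS// subrK.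
rewrite powRS//; ring.
Qed.

(** Substitute [t = b * a ^+ 2] in Euler's integral. The substitution is made on compact intervals;
    both sides then pass to the limit, since the image intervals also exhaust the half-line. *)
Lemma integral_gmom_fun s b : 0 < s -> 0 < b ->
  (\int[mu]_(a in `]0%R, +oo[) (gmom_fun s b a)%:E = (gmom s b)%:E)%E.
Proof.
move=> s0 b0; pose F a := b * a ^+ 2.
have dF a : is_derive a 1 F (2 * b * a).
  apply: is_derive_eq.
  rewrite /GRing.scale/=; ring.
have F'E : (derive1 F) = fun a => 2 * b * a.
  by apply/funext => a; rewrite derive1E; have [_ ->] := dF a.
have cF : continuous F.
  by move=> a; apply/differentiable_continuous/derivable1_diffP; have [] := dF a.
have cF' : continuous (derive1 F) by rewrite F'E => a; exact: mulrl_continuous.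
have iF (a a' : R) : 0 < a -> a <= a' -> F a <= F a'.
  by move=> a0 aa'; rewrite /F ler_pM2l// ler_pXn2r ?nnegrE// ltW// (lt_le_trans a0).
have E n : (\int[mu]_(t in `[F (expand_lo n), F (expand_hi n)]) (gamma_fun s t)%:E =
    (2 * b `^ s)%:E * \int[mu]_(a in `[expand_lo n, expand_hi n]) (gmom_fun s b a)%:E)%E.
  rewrite (@integration_by_substitution_increasing _ F).
  - rewrite -ge0_integralZl//=; last 3 first.
    + by apply/measurable_EFinP; exact: measurable_gmom_fun.
    + by move=> a _; rewrite lee_fin gmom_fun_ge0.
    + by rewrite lee_fin mulr_ge0// powR_ge0.
    apply: eq_integral => a; rewrite inE/= in_itv/= => /andP[a1 _].
    rewrite -EFinM F'E -gamma_fun_subst//.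
    exact: lt_le_trans (expand_lo_gt0 n) a1.
  - exact/ltW/expand_lo_hi.
  - move=> a a'; rewrite !in_itv/= => /andP[a1 _] _ aa'.
    have a0 := lt_le_trans (expand_lo_gt0 n) a1.
    by rewrite /F ltr_pM2l// ltr_pXn2r ?nnegrE// ltW// (lt_trans a0).
  - by move=> a _; exact: cF'.
  - by apply/cvg_ex; eexists; apply: cvg_at_right_filter; exact: cF'.
  - by apply/cvg_ex; eexists; apply: cvg_at_left_filter; exact: cF'.
  - split; first by move=> a _; have [] := dF a.
    + by apply: cvg_at_right_filter; exact: cF.
    + by apply: cvg_at_left_filter; exact: cF.
  - apply: (@continuous_in_subspaceT R R) => t; rewrite inE/= in_itv/= => /andP[t1 _].
    apply: continuous_gamma_fun; apply: lt_le_trans t1.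
    by rewrite mulr_gt0// exprn_gt0// expand_lo_gt0.
have c0 : 2 * b `^ s != 0 by rewrite mulf_neq0// gt_eqF// powR_gt0.
have c1 : ((2 * b `^ s)%:E * \int[mu]_(a in `[expand_lo n, expand_hi n]) (gmom_fun s b a)%:E)%E
    @[n --> \oo] --> (Gamma s)%:E.
  rewrite -(integral_gamma_fun s0); under eq_cvg do rewrite -E.
  apply: (@cvg_integral_itv0y R (F \o expand_lo) (F \o expand_hi)).
  - by move=> m n mn; apply: iF; [exact: expand_lo_gt0|exact: expand_lo_nonincreasing].
  - by move=> n; rewrite /= mulr_gt0// exprn_gt0// expand_lo_gt0.
  - have := @cvg_comp _ _ _ expand_lo F _ _ _ cvg_expand_lo (cF 0).
    by rewrite /F expr0n/= mulr0; apply.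
  - move=> m n mn; apply: iF; last exact: expand_hi_nondecreasing.
    exact: ltr0Sn.
  - apply/cvgryPge => A; near=> n.
    have h1 : (1 : R) <= expand_hi n by rewrite /expand_hi ler1n.
    rewrite /= /F mulrC -ler_pdivrMr// (@le_trans _ _ (expand_hi n : R))//.
      by near: n; apply: (cvgryPge (@expand_hi R)).1; exact: cvg_expand_hi.
    by rewrite expr2 ler_peMl// ltW// (lt_le_trans ltr01).
  - by apply: measurable_funTS; exact: measurable_gamma_fun.
  - by move=> t _; exact: gamma_fun_ge0.
have c2 : ((2 * b `^ s)%:E * \int[mu]_(a in `[expand_lo n, expand_hi n]) (gmom_fun s b a)%:E)%E
    @[n --> \oo] --> ((2 * b `^ s)%:E * \int[mu]_(a in `]0%R, +oo[) (gmom_fun s b a)%:E)%E.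
  apply: cvgeZl => //; apply: cvg_integral_itv0y.
  - exact: expand_lo_nonincreasing.
  - exact: expand_lo_gt0.
  - exact: cvg_expand_lo.
  - exact: expand_hi_nondecreasing.
  - exact: cvg_expand_hi.
  - exact: measurable_gmom_fun.
  - by move=> a _; exact: gmom_fun_ge0.
have c3 := cvg_unique (@ereal_hausdorff R) c1 c2.
by rewrite /gmom mulrC EFinM c3 muleA -EFinM mulVf// mul1e.
Unshelve. all: end_near. Qed.

Lemma integrable_gmom_fun s b : 0 < s -> 0 < b ->
  mu.-integrable `](0 : R), +oo[ (fun a => (gmom_fun s b a)%:E).
Proof.
move=> s0 b0; apply/integrableP; split.
  by apply/measurable_EFinP; exact: measurable_gmom_fun.
under eq_integral do rewrite /= ger0_norm ?gmom_fun_ge0//.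
by rewrite integral_gmom_fun// ltry.
Qed.

(** Half of the Gaussian decay absorbs the linear exponential by completing the square; the other
    half gives an integrable majorant. *)
Lemma integrable_gmom_funM s b c : 0 < s -> 0 < b ->
  mu.-integrable `](0 : R), +oo[ (fun a => (gmom_fun s b a * expR (c * a))%:E).
Proof.
move=> s0 b0.
have le_sq (a : R) : - (b * a ^+ 2) + c * a <= c ^+ 2 / (2 * b) - b / 2 * a ^+ 2.
  rewrite -subr_ge0 (_ : _ - _ = (b * a - c) ^+ 2 / (2 * b)).
    by rewrite divr_ge0 ?sqr_ge0// mulr_ge0// ltW.
  by field; rewrite gt_eqF.
have i := integrable_gmom_fun s0 (divr_gt0 b0 (ltr0n R 2)).
have := integrableZl _ (expR (c ^+ 2 / (2 * b))) i.
move=> /(_ (measurable_itv _)); apply: le_integrable => //=.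
  apply/measurable_EFinP; apply: measurable_funM; first exact: measurable_gmom_fun.
  by apply: measurableT_comp => //; exact: measurable_funM.
move=> a _; rewrite lee_fin !ger0_norm ?mulr_ge0 ?powR_ge0 ?expR_ge0//.
rewrite /gmom_fun [leRHS]mulrCA -[leLHS]mulrA ler_wpM2l ?powR_ge0//.
by rewrite -!expRD ler_expR le_sq.
Qed.

Lemma gmom_fun_exprM s b a d : 0 < a ->
  gmom_fun s b a * a ^+ d = gmom_fun (s + d%:R / 2) b a.
Proof.
move=> a0; rewrite /gmom_fun mulrAC -powR_mulrn ?ltW// -powRD ?(gt_eqF a0) ?implybT//.
by congr (_ `^ _ * _); field.
Qed.

End gaussian_moments.

(** * Termwise integration of power series against a Gaussian moment weight *)

Section termwise.
Context {R : realType}.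
Local Notation mu := (@lebesgue_measure R).
Implicit Types s b a : R.

Lemma series_exp_coeff_le x n : 0 <= x -> series (exp_coeff x) n <= expR x :> R.
Proof.
move=> x0; apply: nondecreasing_cvgn_le; last exact: is_cvg_series_exp_coeff.
by apply: nondecreasing_series => i _ _; exact: exp_coeff_ge0.
Qed.

Lemma integrable_EFinZ (D : set R) c (f : R -> R) : measurable D ->
  mu.-integrable D (fun x => (f x)%:E) -> mu.-integrable D (fun x => (c * f x)%:E).
Proof. by move=> mD fi; under eq_fun do rewrite EFinM; exact: integrableZl. Qed.

(** Both claims go through one induction, since additivity at each step requires integrability of
    the previous partial sum. *)
Lemma Rintegral_sumZ (D : set R) n (c : R^nat) (g : nat -> R -> R) : measurable D ->
    (forall d, mu.-integrable D (fun x => (g d x)%:E)) ->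
  mu.-integrable D (fun x => (\sum_(0 <= d < n) c d * g d x)%:E) /\
  (\int[mu]_(x in D) (\sum_(0 <= d < n) c d * g d x) =
   \sum_(0 <= d < n) c d * \int[mu]_(x in D) g d x)%R.
Proof.
move=> mD ig.
have icg d := integrable_EFinZ (c d) mD (ig d).
elim: n => [|n [IHi IHe]].
  rewrite big_geq//; under eq_fun do rewrite big_geq//; split; first exact: integrable0.
  by under eq_Rintegral do rewrite big_geq//; rewrite Rintegral_cst// mul0r.
split.
  have := @integrableD _ _ R mu D mD _ _ IHi (icg n).
  by apply: eq_integrable => // x _; rewrite big_nat_recr.
rewrite [RHS]big_nat_recr//= -IHe -RintegralZl//; last exact: ig.
rewrite -(@RintegralD _ _ R mu D _ _ mD IHi (icg n)).
by apply: eq_Rintegral => x _; rewrite big_nat_recr.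
Qed.

Lemma Rintegral_dominated_cvg (D : set R) (f_ : nat -> R -> R) (f g : R -> R) :
    measurable D -> (forall n, measurable_fun D (f_ n)) ->
    (forall x, D x -> f_ n x @[n --> \oo] --> f x) ->
    mu.-integrable D (fun x => (g x)%:E) ->
    (forall n x, D x -> `|f_ n x| <= g x) ->
  mu.-integrable D (fun x => (f x)%:E) /\
  (\int[mu]_(x in D) f_ n x)%R @[n --> \oo] --> (\int[mu]_(x in D) f x)%R.
Proof.
move=> mD mf_ cf ig dom.
have mf_E n : measurable_fun D (EFin \o f_ n) by exact/measurable_EFinP.
have cfE x : D x -> (f_ n x)%:E @[n --> \oo] --> (f x)%:E.
  by move=> Dx; apply: cvg_EFin; [exact: nearW|exact: cf].
have mf : measurable_fun D (fun x => (f x)%:E).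
  by apply: (emeasurable_fun_cvg (fun n x => (f_ n x)%:E)) => // x Dx; exact: cfE.
have [If _ cI] := @dominated_convergence _ _ R mu D mD (fun n x => (f_ n x)%:E)
  (fun x => (f x)%:E) (fun x => (g x)%:E) mf_E mf (aeW mu cfE) ig
  (aeW mu (fun x n Dx => dom n x Dx)).
split=> //; apply: fine_cvg; rewrite fineK//.
exact: integrable_fin_num.
Qed.

(** The coefficient bound puts every partial sum below [expR (rho * a)], so dominated convergence
    applies. It serves twice: for a cosine with [s = 1 / 2] and for the exponential in the envelope
    integral. *)
Lemma Rintegral_gmom_series s b rho (c : R^nat) (f : R -> R) :
    0 < s -> 0 < b -> 0 <= rho ->
    (forall d, `|c d| <= rho ^+ d / d`!%:R) ->
    (forall a, 0 < a -> series (fun d => c d * a ^+ d) @ \oo --> f a) ->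
  mu.-integrable `](0 : R), +oo[ (fun a => (gmom_fun s b a * f a)%:E) /\
  series (fun d => c d * gmom (s + d%:R / 2) b) @ \oo -->
    (\int[mu]_(a in `]0%R, +oo[) (gmom_fun s b a * f a))%R.
Proof.
move=> s0 b0 rho0 cb cf.
(* Partial sums with each power of [a] absorbed into the shape, so that every term integrates to a
   [gmom]. *)
pose f_ n a := \sum_(0 <= d < n) c d * gmom_fun (s + d%:R / 2) b a.
have f_E n a : 0 < a -> f_ n a = gmom_fun s b a * series (fun d => c d * a ^+ d) n.
  move=> a0; rewrite /f_ /series/= mulr_sumr; apply: eq_bigr => d _.
  by rewrite -gmom_fun_exprM// mulrCA.
have sd0 d : 0 < s + d%:R / 2 by rewrite ltr_wpDr// divr_ge0.
have [||||If] := @Rintegral_dominated_cvg `](0 : R), +oo[ f_ (fun a => gmom_fun s b a * f a)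
  (fun a => gmom_fun s b a * expR (rho * a)) (measurable_itv _).
- move=> n; apply: measurable_sum => d.
  by apply: measurable_funM => //; exact: measurable_gmom_fun.
- move=> a; rewrite /= in_itv/= andbT => a0.
  under eq_cvg do rewrite f_E//.
  by apply: cvgMr; exact: cf.
- exact: integrable_gmom_funM.
- move=> n a; rewrite /= in_itv/= andbT => a0; rewrite f_E// normrM ger0_norm ?gmom_fun_ge0//.
  rewrite ler_wpM2l ?gmom_fun_ge0//.
  rewrite (le_trans _ (series_exp_coeff_le n (mulr_ge0 rho0 (ltW a0))))//.
  rewrite (le_trans (ler_norm_sum _ _ _))// ler_sum// => d _.
  rewrite normrM /exp_coeff/= exprMn mulrAC normrX (gtr0_norm a0).
  by rewrite ler_wpM2r ?exprn_ge0// ltW.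
have fE n : (\int[mu]_(a in `]0%R, +oo[) f_ n a)%R =
    series (fun d => c d * gmom (s + d%:R / 2) b) n.
  have [_ ->//] := @Rintegral_sumZ `](0 : R), +oo[ n c
    (fun d => gmom_fun (s + d%:R / 2) b) (measurable_itv _)
    (fun d => integrable_gmom_fun (sd0 d) b0).
  by apply: eq_bigr => d _; rewrite /Rintegral integral_gmom_fun.
by under eq_cvg do rewrite fE.
Qed.

End termwise.

(** * Gaussian mean of a cosine *)

Section gaussian_phase.
Context {R : realType}.
Local Notation mu := (@lebesgue_measure R).
Implicit Types s b a : R.

Lemma pochhammerS s n : pochhammer s n.+1 = pochhammer s n * (s + n%:R).
Proof. by rewrite /pochhammer big_ord_recr. Qed.

Lemma gmom_addn s b n : 0 < s -> 0 < b ->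
  gmom (s + n%:R) b = gmom s b * (pochhammer s n / b ^+ n).
Proof.
move=> s0 b0; rewrite /gmom Gamma_addn// powRD ?(gt_eqF b0) ?implybT//.
rewrite powR_mulrn ?ltW//; field.
by rewrite !gt_eqF ?exprn_gt0 ?powR_gt0.
Qed.

Lemma pochhammer_half n : pochhammer (1 / 2) n = n.*2`!%:R / (4 ^+ n * n`!%:R) :> R.
Proof.
elim: n => [|n IH]; first by rewrite /pochhammer big_ord0 !fact0; field.
rewrite pochhammerS IH doubleS !factS !natrM exprS -!natr1 -mul2n natrM.
by field; rewrite !gt_eqF ?exprn_gt0 ?ltr0n ?fact_gt0// -?natr1 ?ltr_wpDl.
Qed.

(** The odd coefficients vanish, so [n.*2] terms of the cosine expansion amount to [n] terms of the
    exponential. *)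
Lemma series_cos_gmom b k n : 0 < b ->
  series (fun d => (~~ odd d)%:R * (-1) ^+ d./2 * d`!%:R^-1 * k ^+ d *
    gmom (1 / 2 + d%:R / 2) b) n.*2 =
  gmom (1 / 2) b * series (exp_coeff (- (k ^+ 2 / (4 * b)))) n.
Proof.
move=> b0; elim: n => [|n IH]; first by rewrite /series/= !big_geq// mulr0.
rewrite doubleS /series/= big_nat_recr//= big_nat_recr//= -/(series _ n.*2).
move: IH; rewrite /series/= => ->; rewrite big_nat_recr//= mulrDr.
rewrite odd_double/= !mul0r addr0 doubleK; congr (_ + _).
have -> : n.*2%:R / 2 = n%:R :> R by rewrite -muln2 natrM mulfK.
rewrite gmom_addn ?divr_gt0// pochhammer_half /exp_coeff/= (exprNn (_ / _)) expr_div_n.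
rewrite [(4 * b) ^+ n]exprMn -mul2n exprM.
field.
by rewrite !gt_eqF ?exprn_gt0 ?ltr0n ?fact_gt0.
Qed.

Lemma integral_gmom_cos b k : 0 < b ->
  mu.-integrable `](0 : R), +oo[ (fun a => (gmom_fun (1 / 2) b a * cos (k * a))%:E) /\
  (\int[mu]_(a in `]0%R, +oo[) (gmom_fun (1 / 2) b a * cos (k * a)) =
   gmom (1 / 2) b * expR (- (k ^+ 2 / (4 * b))))%R.
Proof.
move=> b0.
have [||||I cI] := @Rintegral_gmom_series _ (1 / 2) b `|k|
  (fun d => (~~ odd d)%:R * (-1) ^+ d./2 * d`!%:R^-1 * k ^+ d) (fun a => cos (k * a)) _ b0.
- by rewrite divr_gt0.
- exact: normr_ge0.
- move=> d; rewrite !normrM normrX normfV !normr_nat normrX normrN1 expr1n mulr1.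
  rewrite -mulrA mulrC; case: odd => /=; first by rewrite mulr0 divr_ge0 ?exprn_ge0.
  by rewrite mulr1 mulrC.
- move=> a _; have -> : (fun d => (~~ odd d)%:R * (-1) ^+ d./2 * d`!%:R^-1 * k ^+ d * a ^+ d) =
      cos_coeff (k * a).
    by apply/funext => d; rewrite cos_coeffE exprMn mulrA.
  by rewrite unlock; exact: is_cvg_series_cos_coeff.
split => //.
(* The full series converges already, so its limit may be read along even indices. *)
have dbl : n.*2 @[n --> \oo] --> \oo.
  by apply/cvgnyPge => A; exists A => // n /= An; rewrite (leq_trans An)// -addnn leq_addr.
have := cvg_comp _ _ dbl cI.
under [X in X -> _]eq_cvg do rewrite /= series_cos_gmom//.
move=> h; apply: (cvg_unique _ h) => //.
apply: cvgMr; exact: is_cvg_series_exp_coeff.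
Qed.

(** Cut the line at [c] and reflect the left half. This brings a Gaussian integral over the line to
    the half-line, where its moments are known. *)
Lemma integralT_fold (c : R) (G : R -> R) : (forall x, 0 <= G x) -> continuous G ->
  (\int[mu]_x (G x)%:E =
   \int[mu]_(t in `]0%R, +oo[) (G (c + t) + G (c - t))%:E)%E.
Proof.
move=> G0 cG.
have mG D : measurable_fun D (fun x => (G x)%:E).
  by apply/measurable_EFinP; apply: measurable_funTS; exact: continuous_measurable_fun.
have dp (x : R) : is_derive x 1 (fun t : R => c + t) 1.
  exact: is_derive_eq (is_deriveD (is_derive_cst c x 1) (is_derive_id x 1)) (add0r _).
have dm (x : R) : is_derive x 1 (fun t : R => c - t) (-1).
  exact: is_derive_eq (is_deriveB (is_derive_cst c x 1) (is_derive_id x 1)) (sub0r _).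
have dpE : derive1 (fun t : R => c + t) = cst 1.
  by apply/funext => x; rewrite derive1E; have [_ ->] := dp x.
have dmE : derive1 (fun t : R => c - t) = cst (-1).
  by apply/funext => x; rewrite derive1E; have [_ ->] := dm x.
have cp : continuous (fun t : R => c + t).
  by move=> x; apply/differentiable_continuous/derivable1_diffP; have [] := dp x.
have cm : continuous (fun t : R => c - t).
  by move=> x; apply/differentiable_continuous/derivable1_diffP; have [] := dm x.
have Ep : (\int[mu]_(x in `[c, +oo[) (G x)%:E = \int[mu]_(t in `[0%R, +oo[) (G (c + t))%:E)%E.
  rewrite -{1}(addr0 c) (@increasing_ge0_integration_by_substitutiony _ (fun t => c + t)).
  - by apply: eq_integral => t _; rewrite dpE /= mulr1.
  - by move=> x y _ _ xy; rewrite ltrD2l.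
  - by rewrite dpE => x _; exact: cvg_cst.
  - by rewrite dpE; exact: is_cvg_cst.
  - by rewrite dpE; exact: is_cvg_cst.
  - by split; [move=> x _; have [] := dp x|apply: cvg_at_right_filter; exact: cp].
  - by apply: cvg_addrl.
  - by apply: (@continuous_in_subspaceT R R) => x _; exact: cG.
  - by move=> x _; exact: G0.
have Em : (\int[mu]_(x in `]-oo, c]) (G x)%:E = \int[mu]_(t in `[0%R, +oo[) (G (c - t))%:E)%E.
  rewrite -{1}(subr0 c) (@decreasing_ge0_integration_by_substitutiony _ (fun t => c - t)).
  - by apply: eq_integral => t _; rewrite dmE /= opprK mulr1.
  - by move=> x y _ _ xy; rewrite ltrD2l ltrN2.
  - by rewrite dmE => x _; exact: cvg_cst.
  - by rewrite dmE; exact: is_cvg_cst.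
  - by rewrite dmE; exact: is_cvg_cst.
  - by split; [move=> x _; have [] := dm x|apply: cvg_at_right_filter; exact: cm].
  - apply/cvgNry; under eq_cvg do rewrite opprB addrC; exact: cvg_addrl.
  - by apply: (@continuous_in_subspaceT R R) => x _; exact: cG.
  - by move=> x _; exact: G0.
rewrite integral_itv_obnd_cbnd; last first.
  apply/measurable_EFinP; apply: measurable_funTS; apply: continuous_measurable_fun.
  by move=> t; apply: cvgD; (apply: continuous_comp; [exact: cp || exact: cm|exact: cG]).
under [RHS]eq_integral do rewrite EFinD.
rewrite ge0_integralD//=; last 4 first.
- by move=> t _; rewrite lee_fin.
- apply/measurable_EFinP; apply: measurable_funTS; apply: continuous_measurable_fun => t.
  by apply: continuous_comp; [exact: cp|exact: cG].
- by move=> t _; rewrite lee_fin.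
- apply/measurable_EFinP; apply: measurable_funTS; apply: continuous_measurable_fun => t.
  by apply: continuous_comp; [exact: cm|exact: cG].
rewrite -Ep -Em addeC -(integral_itv_obnd_cbnd (mG _)) -ge0_integral_setU//=.
- by rewrite -itv_bndbnd_setU// set_itvNyy.
- exact: mG.
- by move=> x _; rewrite lee_fin.
- apply/disj_setPS => x /= []; rewrite !in_itv/= andbT => xc.
  by rewrite ltNge xc.
Qed.

End gaussian_phase.

Section normal_cos.
Context {R : realType}.
Local Notation mu := (@lebesgue_measure R).
Implicit Types c sigma k phi x : R.

Lemma continuous_cosM k phi : continuous (fun x : R => cos (k * (x - phi))).
Proof.
move=> x; apply: continuous_comp; last exact: continuous_cos.
apply: cvgMr; apply: cvgB; [exact: cvg_id|exact: cvg_cst].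
Qed.

Lemma integrable_normal_pdfM c sigma (f : R -> R) B :
    measurable_fun setT f -> (forall x, `|f x| <= B) ->
  mu.-integrable setT (fun x => (normal_pdf c sigma x * f x)%:E).
Proof.
move=> mf fB; have := integrableZl measurableT B (integrable_normal_pdf c sigma).
apply: le_integrable => //.
  by apply/measurable_EFinP; apply: measurable_funM => //; exact: measurable_normal_pdf.
move=> x _; rewrite /= lee_fin !normrM mulrC ler_wpM2r//.
exact: le_trans (fB x) (ler_norm B).
Qed.

Lemma normal_pdf_gmom c sigma t : 0 < sigma ->
  normal_pdf c sigma (c + t) = normal_peak sigma * gmom_fun (1 / 2) (1 / (2 * sigma ^+ 2)) t.
Proof.
move=> s0; rewrite normal_pdfE ?gt_eqF// /gmom_fun /normal_fun.
have -> : 2 * (1 / 2) - 1 = 0 :> R by field.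
rewrite powRr0 mul1r; congr (_ * expR _).
by rewrite (addrC c) addrK -mulr_natl; field; rewrite gt_eqF.
Qed.

(* The 1 makes the integrand nonnegative, as folding the line requires; the case
   k = 0 identifies the normalizing constant. *)
Lemma Rintegral_normal_cosD1 c sigma k phi : 0 < sigma ->
  (1 + \int[mu]_x (normal_pdf c sigma x * cos (k * (x - phi))) =
   2 * normal_peak sigma * gmom (1 / 2) (1 / (2 * sigma ^+ 2)) *
     (1 + cos (k * (c - phi)) * expR (- (1 / 2) * sigma ^+ 2 * k ^+ 2)))%R.
Proof.
move=> s0; set b := 1 / (2 * _); have b0 : 0 < b by rewrite divr_gt0// mulr_gt0// exprn_gt0.
pose G x := normal_pdf c sigma x * (1 + cos (k * (x - phi))).
have G0 x : 0 <= G x.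
  by rewrite /G mulr_ge0 ?normal_pdf_ge0.
have cG : continuous G.
  move=> x; apply: cvgM; first by apply: continuous_normal_pdf; rewrite gt_eqF.
  apply: cvgD; [exact: cvg_cst|exact: continuous_cosM].
have inc : mu.-integrable setT (fun x => (normal_pdf c sigma x * cos (k * (x - phi)))%:E).
  apply: (@integrable_normal_pdfM c sigma _ 1); last by move=> x; exact: cos_max.
  by apply: continuous_measurable_fun; exact: continuous_cosM.
have -> : (1 + \int[mu]_x (normal_pdf c sigma x * cos (k * (x - phi))) = \int[mu]_x G x)%R.
  have -> : (1 = \int[mu]_x normal_pdf c sigma x)%R.
    by rewrite /Rintegral integral_normal_pdf.
  rewrite -(@RintegralD _ _ R mu setT _ _ measurableT (integrable_normal_pdf c sigma) inc).
  by apply: eq_Rintegral => x _; rewrite /G [RHS]mulrDr mulr1.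
rewrite {1}/Rintegral (integralT_fold c)// -/(Rintegral mu _ _).
have [i1 e1] := integral_gmom_cos k b0.
(* The density is even about [c], so the sine parts at [c + t] and [c - t] cancel. *)
transitivity (\int[mu]_(t in `]0%R, +oo[)
   (2 * normal_peak sigma * gmom_fun (1 / 2) b t +
    2 * normal_peak sigma * cos (k * (c - phi)) * (gmom_fun (1 / 2) b t * cos (k * t))))%R.
  apply: eq_Rintegral => t _; rewrite /G.
  have gN : gmom_fun (1 / 2) b (- t) = gmom_fun (1 / 2) b t.
    rewrite /gmom_fun; have -> : 2 * (1 / 2) - 1 = 0 :> R by field.
    by rewrite !powRr0 sqrrN.
  rewrite !normal_pdf_gmom// gN -/b.
  have -> : k * (c + t - phi) = k * (c - phi) + k * t by ring.
  have -> : k * (c - t - phi) = k * (c - phi) - k * t by ring.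
  by rewrite cosD cosB; ring.
have i0 := integrable_gmom_fun (divr_gt0 ltr01 (ltr0n R 2)) b0.
rewrite (@RintegralD _ _ R mu _ _ _ (measurable_itv _) 
  (integrable_EFinZ _ (measurable_itv _) i0) (integrable_EFinZ _ (measurable_itv _) i1)).
rewrite RintegralZl// RintegralZl//.
rewrite e1 {1}/Rintegral (integral_gmom_fun (divr_gt0 ltr01 (ltr0n R 2)) b0) /=.
have -> : - (k ^+ 2 / (4 * b)) = - (1 / 2) * sigma ^+ 2 * k ^+ 2.
  by rewrite /b; field; rewrite gt_eqF.
ring.
Qed.

Lemma Rintegral_normal_cos c sigma k phi : 0 < sigma ->
  (\int[mu]_x (normal_pdf c sigma x * cos (k * (x - phi))) =
   cos (k * (c - phi)) * expR (- (1 / 2) * sigma ^+ 2 * k ^+ 2))%R.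
Proof.
move=> s0; have h0 := Rintegral_normal_cosD1 c 0 phi s0.
have hk := Rintegral_normal_cosD1 c k phi s0.
have norm1 : 2 * normal_peak sigma * gmom (1 / 2) (1 / (2 * sigma ^+ 2)) = 1.
  move: h0; rewrite !mul0r cos0 expr0n/= mulr0 expR0.
  have -> : (\int[mu]_x (normal_pdf c sigma x * cos (0 * (x - phi))) = 1)%R.
    under eq_Rintegral do rewrite mul0r cos0 mulr1.
    by rewrite /Rintegral integral_normal_pdf.
  by set X := _ * gmom _ _; move=> h; lra.
by apply: (addrI 1); rewrite hk norm1 mul1r.
Qed.

End normal_cos.

(** * Modified Bessel coefficients and rearrangement *)

Section bessel_coefficients.
Context {R : realType}.
Implicit Types (d k n : nat).

(* The coefficient of x^d in the modified Bessel function I_k(2x); the recursion is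
   2 cos psi cos (k psi) = cos ((k+1) psi) + cos ((k-1) psi), where k - 1 is read as
   1 when k = 0. *)
Fixpoint bessel_coef d k : R :=
  if d is d'.+1 then
    (bessel_coef d' k.+1 + (if k is k'.+1 then bessel_coef d' k' else bessel_coef d' 1)) / d%:R
  else (k == 0)%:R.

Lemma bessel_coefS d k : bessel_coef d.+1 k =
  (bessel_coef d k.+1 + (if k is k'.+1 then bessel_coef d k' else bessel_coef d 1)) / d.+1%:R.
Proof. by []. Qed.

Lemma bessel_coef_ge0 d k : 0 <= bessel_coef d k.
Proof.
elim: d k => [|d IH] k; first exact: ler0n.
by rewrite /= divr_ge0 ?ler0n// addr_ge0//; case: k.
Qed.

Lemma bessel_coef_gt d k : (d < k)%N -> bessel_coef d k = 0.
Proof.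
elim: d k => [|d IH] [|k]//= dk.
by rewrite !IH ?addr0 ?mul0r//; lia.
Qed.

Lemma bessel_coef_odd d k : odd (d + k) -> bessel_coef d k = 0.
Proof.
elim: d k => [|d IH] [|k]//= dk.
  by rewrite IH ?addr0 ?mul0r//; lia.
by rewrite !IH ?addr0 ?mul0r//; lia.
Qed.

(** Strong induction on the degree, split by whether [k] and [n] vanish. In the generic case the two
    neighbours combine because the degree is the sum [n.+1 + (n + k).+2]. *)
Lemma bessel_coef_diag k n : bessel_coef (k + n.*2) k = (n`! * (n + k)`!)%:R^-1.
Proof.
have [d] := ubnP (k + n.*2)%N; elim: d k n => // d IH [|k] [|n] lt_d.
- by rewrite /= invr1.
- have -> : (0 + n.+1.*2 = (1 + n.*2).+1)%N by lia.
  rewrite bessel_coefS IH; last by lia.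
  rewrite addn1 addn0.
  have -> : (1 + n.*2).+1%:R = 2 * n.+1%:R :> R by rewrite -natrM; congr _%:R; lia.
  rewrite !factS !natrM.
  have : n.+1%:R != 0 :> R by rewrite pnatr_eq0.
  have : n`!%:R != 0 :> R by rewrite pnatr_eq0 -lt0n fact_gt0.
  move: (n.+1%:R : R) (n`!%:R : R) => x y y0 x0.
  by field; rewrite x0 y0.
- rewrite addSn /= addn0 (@bessel_coef_gt k k.+2)// add0r.
  have := IH k 0%N; rewrite !addn0 !add0n => ->; last by lia.
  by rewrite !fact0 !mul1n factS natrM invfM mulrC.
- rewrite addSn /=; have -> : (k + n.+1.*2 = k.+2 + n.*2)%N by lia.
  rewrite IH; last by lia.
  have -> : (k.+2 + n.*2 = k + n.+1.*2)%N by lia.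
  rewrite IH; last by lia.
  have -> : (n + k.+2 = (n + k).+2)%N by lia.
  have -> : (n.+1 + k = (n + k).+1)%N by lia.
  have -> : (n.+1 + k.+1 = (n + k).+2)%N by lia.
  have -> : (k + n.+1.*2).+1%:R = n.+1%:R + (n + k).+2%:R :> R.
    by rewrite -natrD; congr _%:R; lia.
  rewrite !factS !natrM.
  have : (n + k)`!%:R != 0 :> R by rewrite pnatr_eq0 -lt0n fact_gt0.
  have : n`!%:R != 0 :> R by rewrite pnatr_eq0 -lt0n fact_gt0.
  have : (n + k).+1%:R != 0 :> R by rewrite pnatr_eq0.
  have : n.+1%:R + (n + k).+2%:R != 0 :> R by rewrite -natrD pnatr_eq0.
  have : (n + k).+2%:R != 0 :> R by rewrite pnatr_eq0.
  have : n.+1%:R != 0 :> R by rewrite pnatr_eq0.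
  move: (n.+1%:R : R) ((n + k).+2%:R : R) ((n + k).+1%:R : R) (n`!%:R : R) ((n + k)`!%:R : R).
  move=> a b c e g a0 b0 ab0 c0 e0 g0.
  by field; rewrite a0 b0 ab0 c0 e0 g0.
Qed.

(** Multiply the expansion of degree [d] by [2 * cos psi] and apply the product-to-sum formula; this
    is the recursion of [bessel_coef]. Any [N >= d] is allowed because higher coefficients
    vanish. *)
Lemma bessel_coef_cos psi d N : (d <= N)%N ->
  (2 * cos psi) ^+ d / d`!%:R =
  bessel_coef d 0 + 2 * \sum_(0 <= k < N) bessel_coef d k.+1 * cos (k.+1%:R * psi).
Proof.
elim: d N => [|d IH] N dN.
  rewrite expr0 fact0 invr1 big1 ?mulr0 ?addr0 ?mulr1// => k _.
  by rewrite /= mul0r.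
case: N dN => // N dN.
have d1 : d.+1%:R != 0 :> R by rewrite pnatr_eq0.
apply: (mulfI d1).
have -> : d.+1%:R * ((2 * cos psi) ^+ d.+1 / (d.+1)`!%:R) =
    2 * cos psi * ((2 * cos psi) ^+ d / d`!%:R).
  rewrite factS natrM exprS.
  have : d`!%:R != 0 :> R by rewrite pnatr_eq0 -lt0n fact_gt0.
  move: (d.+1%:R : R) (d`!%:R : R) d1 => x y x0 y0.
  by field; rewrite x0 y0.
(* Coefficients up to index [N.+2] occur in the recursion; the surplus terms at raised frequency are
   removed by [sum2]. *)
rewrite (IH N.+2); last by lia.
have -> : d.+1%:R * (bessel_coef d.+1 0 +
      2 * \sum_(0 <= k < N.+1) bessel_coef d.+1 k.+1 * cos (k.+1%:R * psi)) =
    2 * bessel_coef d 1 + 2 * (\sum_(0 <= k < N.+1) bessel_coef d k.+2 * cos (k.+1%:R * psi) +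
      \sum_(0 <= k < N.+1) bessel_coef d k * cos (k.+1%:R * psi)).
  rewrite -big_split/= mulrDr; congr (_ + _).
    by rewrite mulrC divfK// -mulr2n mulr_natl.
  rewrite mulrCA mulr_sumr; congr (2 * _); apply: eq_bigr => k _.
  by rewrite mulrA [_ * (_ / _)]mulrC divfK// mulrDl.
have -> : 2 * cos psi * (bessel_coef d 0 +
      2 * \sum_(0 <= k < N.+2) bessel_coef d k.+1 * cos (k.+1%:R * psi)) =
    2 * (bessel_coef d 0 * cos psi +
      (\sum_(0 <= k < N.+2) bessel_coef d k.+1 * cos (k.+2%:R * psi) +
       \sum_(0 <= k < N.+2) bessel_coef d k.+1 * cos (k%:R * psi))).
  rewrite -mulrA; congr (2 * _); rewrite mulrDr mulrC; congr (_ + _).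
  rewrite -big_split/= mulrCA !mulr_sumr; apply: eq_bigr => k _.
  have -> : k.+2%:R * psi = k.+1%:R * psi + psi by rewrite -!natr1; ring.
  have -> : k%:R * psi = k.+1%:R * psi - psi by rewrite -!natr1; ring.
  by rewrite cosD cosB; ring.
rewrite [X in _ = _ + 2 * (_ + X)]big_nat_recl//= mul1r.
rewrite [X in 2 * (_ + (_ + X))]big_nat_recl//= mul0r cos0 mulr1.
have sum2 : \sum_(0 <= k < N.+2) bessel_coef d k.+1 * cos (k.+2%:R * psi) =
    \sum_(0 <= k < N) bessel_coef d k.+1 * cos (k.+2%:R * psi).
  rewrite !big_nat_recr//= (@bessel_coef_gt d N.+1)// (@bessel_coef_gt d N.+2); last by lia.
  by rewrite !mul0r !addr0.
by rewrite sum2; ring.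
Qed.

End bessel_coefficients.

Section series_exchange.
Context {R : realType}.

(** Fubini for a triangular array whose columns are absolutely bounded by a summable [s]: the two
    truncations differ by a tail of [s]. *)
Lemma cvg_series_exchange (f : nat -> nat -> R) (s F : R^nat) (L : R) :
    (forall k d, (d < k)%N -> f k d = 0) ->
    (forall d N, \sum_(0 <= k < N) `|f k d| <= s d) ->
    cvgn (series s) -> (forall k, series (f k) @ \oo --> F k) ->
    series (fun d => \sum_(0 <= k < d.+1) f k d) @ \oo --> L ->
  series F @ \oo --> L.
Proof.
move=> f0 fs cs cF cL.
have s0 d : 0 <= s d by have := fs d 0%N; rewrite big_geq.
(* Columns [d < n] agree exactly, as their nonzero entries have [k <= d < n]. Only columns from [n]
   to [m] contribute to the difference. *)
have fin n m : (n <= m)%N ->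
    `|\sum_(0 <= k < n) series (f k) m -
      series (fun d => \sum_(0 <= k < d.+1) f k d) m| <= series s m - series s n.
  move=> nm; rewrite /series/= exchange_big/= -sumrB.
  rewrite (@big_cat_nat _ _ _ n 0 m)//= [in X in _ <= X](@big_cat_nat _ _ _ n 0 m)//=.
  rewrite [X in _ <= X]addrC addKr big_nat big1 ?add0r; last first.
    move=> d /andP[_ dn]; rewrite (@big_cat_nat _ _ _ d.+1 0 n)//= addrAC subrr add0r.
    by rewrite big_nat big1// => k /andP[dk _]; exact: f0.
  rewrite (le_trans (ler_norm_sum _ _ _))// ler_sum_nat// => d.
  move=> /andP[nd _]; rewrite (@big_cat_nat _ _ _ n 0 d.+1)//=; last by lia.
  rewrite opprD addrA subrr add0r normrN (le_trans (ler_norm_sum _ _ _))//.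
  rewrite (le_trans _ (fs d d.+1))// [X in _ <= X](@big_cat_nat _ _ _ n)//=; last by lia.
  by rewrite lerDr sumr_ge0.
have cFn n : (fun m => \sum_(0 <= k < n) series (f k) m) @ \oo --> series F n.
  elim: n => [|n IH].
    by under eq_fun do rewrite big_geq//; rewrite /series/= big_geq//; exact: cvg_cst.
  under eq_fun do rewrite big_nat_recr//=.
  by rewrite seriesSr; exact: cvgD.
have bnd n : `|series F n - L| <= limn (series s) - series s n.
  have c1 : (fun m => \sum_(0 <= k < n) series (f k) m -
      series (fun d => \sum_(0 <= k < d.+1) f k d) m) @ \oo --> series F n - L.
    exact: cvgB (cFn n) cL.
  have c2 : (fun m => series s m - series s n) @ \oo --> limn (series s) - series s n.
    by apply: cvgB => //; exact: cvg_cst.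
  rewrite -(cvg_lim _ (cvg_norm c1))// -(cvg_lim _ c2)//.
  apply: ler_lim.
  - by apply/cvg_ex; eexists; exact: cvg_norm c1.
  - by apply/cvg_ex; eexists; exact: c2.
  - by exists n => // m /=; exact: fin.
have tail : (fun n => limn (series s) - series s n) @ \oo --> 0.
  by rewrite -(subrr (limn (series s))); apply: cvgB => //; exact: cvg_cst.
apply/cvgrPdist_le => e e0; near=> n.
rewrite distrC (le_trans (bnd n))//; near: n.
exact: (cvgr_le 0 tail).
Unshelve. all: end_near. Qed.

End series_exchange.

(** * Resummation into confluent hypergeometric functions *)

Section radial.
Context {R : realType}.
Implicit Types (m Omega s b r phi : R) (d k n : nat).

Lemma beta_coef_gt0 m Omega : 0 < m -> 0 < Omega -> 0 < beta_coef m Omega.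
Proof. by move=> m0 O0; rewrite addr_gt0// divr_gt0. Qed.

(** For [0 < m] and [0 < b], the integral of [(r * a) ^+ d] against [gmom_fun m b]. *)
Definition radial_moment m b r d : R := r ^+ d * gmom (m + d%:R / 2) b.

Lemma pochhammer_fact k n : (n + k)`!%:R = k`!%:R * pochhammer (k%:R + 1) n :> R.
Proof.
elim: n => [|n IH]; first by rewrite /pochhammer big_ord0 mulr1.
by rewrite addSn factS natrM IH pochhammerS -natr1 natrD; ring.
Qed.

(** Only degrees [k + n.*2] contribute. There the Gamma shift supplies the upper Pochhammer symbol,
    and [(n + k)]![splits into]k[!] and the lower one. *)
Lemma series_radial m b r k n : 0 < m -> 0 < b ->
  series (fun d => radial_moment m b r d * bessel_coef d k) (k + n.*2)%N =
  Gamma (m + k%:R / 2) / (2 * b `^ (m + k%:R / 2) * k`!%:R) * r ^+ k *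
  pseries (fun n => pochhammer (m + k%:R / 2) n / (pochhammer (k%:R + 1) n * n`!%:R))
    (r ^+ 2 / b) n.
Proof.
move=> m0 b0; have s0 : 0 < m + k%:R / 2 by rewrite ltr_wpDr// divr_ge0.
elim: n => [|n IH].
  rewrite addn0 /pseries /series/= [in RHS]big_geq// mulr0 big_nat big1// => d /andP[_ dk].
  by rewrite bessel_coef_gt// mulr0.
rewrite doubleS !addnS !seriesSr IH bessel_coef_diag.
rewrite bessel_coef_odd; last by lia.
rewrite mulr0 addr0 /pseries seriesSr/= mulrDr; congr (_ + _).
rewrite /radial_moment natrD -muln2 natrM mulrDl mulfK// addrA gmom_addn//.
rewrite natrM pochhammer_fact exprD muln2 -mul2n exprM /gmom expr_div_n.
have : k`!%:R != 0 :> R by rewrite pnatr_eq0 -lt0n fact_gt0.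
have : n`!%:R != 0 :> R by rewrite pnatr_eq0 -lt0n fact_gt0.
have : b `^ (m + k%:R / 2) != 0 by rewrite gt_eqF// powR_gt0.
have : b ^+ n != 0 by rewrite gt_eqF// exprn_gt0.
have : pochhammer (k%:R + 1) n != 0 :> R.
  apply/eqP => p0; have := pochhammer_fact k n; rewrite p0 mulr0 => /eqP.
  by rewrite pnatr_eq0 eqn0Ngt fact_gt0.
move: (k`!%:R : R) (n`!%:R : R) (b `^ _) (b ^+ n) (pochhammer (_ + 1) n) (Gamma _)
  => x y z t u v u0 t0 z0 y0 x0.
by field; rewrite x0 y0 z0 t0 u0.
Qed.

(** Since [hyp1F1] is a [limn], its series must be shown to converge. This follows from the sum over
    [d], read along [k + n.*2] and divided by the prefactor. *)
Lemma cvg_radial_term m Omega r k : 0 < m -> 0 < Omega ->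
    cvgn (series (fun d => radial_moment m (beta_coef m Omega) r d * bessel_coef d k)) ->
  series (fun d => radial_moment m (beta_coef m Omega) r d * bessel_coef d k) @ \oo -->
    radial_term m Omega k r.
Proof.
move=> m0 O0 /cvg_ex[/= l cl]; suff -> : radial_term m Omega k r = l by [].
have b0 := beta_coef_gt0 m0 O0.
rewrite /radial_term /hyp1F1; set c := Gamma _ / _ * _.
set p := pseries _ _.
have cp : c * p n @[n --> \oo] --> l.
  have sub : (k + n.*2)%N @[n --> \oo] --> \oo.
    apply/cvgnyPge => A; exists A => // n /= An.
    by rewrite (leq_trans An)// -addnn addnA leq_addl.
  have := cvg_comp _ _ sub cl.
  by under eq_cvg do rewrite /= series_radial//.
(* The prefactor vanishes when [r = 0] and [k > 0]; both sides are then 0, whatever the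
   hypergeometric value. *)
have [c0|c0] := eqVneq c 0.
  rewrite -(cvg_lim _ cp)// c0 mul0r; under eq_fun do rewrite mul0r.
  by rewrite lim_cst.
have cpl : p n @[n --> \oo] --> c^-1 * l.
  have pE n : p n = c^-1 * (c * p n) by rewrite mulKf.
  by under eq_cvg do rewrite pE; apply: cvgM cp; exact: cvg_cst.
by rewrite (cvg_lim _ cpl)// mulVKf.
Qed.

End radial.

(** * The averaged likelihood *)

Section phase_average.
Context {R : realType}.
Local Notation mu := (@lebesgue_measure R).
Context (m b r c sigma phi : R).
Context (m0 : 0 < m) (b0 : 0 < b) (r0 : 0 <= r) (sigma0 : 0 < sigma).

Definition envelope_avg (u : R) : R :=
  (\int[mu]_(a in `]0%R, +oo[) (gmom_fun m b a * expR (2 * r * u * a)))%R.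

(** The bound on [u], which will be a cosine, makes [2 * r] a valid growth rate for the exponential
    coefficients. *)
Lemma envelope_avg_series (u : R) : `|u| <= 1 ->
  mu.-integrable `](0 : R), +oo[ (fun a => (gmom_fun m b a * expR (2 * r * u * a))%:E) /\
  series (fun d => radial_moment m b r d * ((2 * u) ^+ d / d`!%:R)) @ \oo --> envelope_avg u.
Proof.
move=> u1; have [|||i ci] := @Rintegral_gmom_series _ m b (2 * r)
   (fun d => (2 * r * u) ^+ d / d`!%:R) (fun a => expR (2 * r * u * a)) m0 b0.
- by rewrite mulr_ge0.
- move=> d; rewrite normrM normfV normr_nat ler_wpM2r ?invr_ge0// normrX.
  rewrite lerXn2r ?nnegrE ?mulr_ge0//.
  by rewrite normrM ger0_norm ?mulr_ge0// ler_piMr ?mulr_ge0.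
- move=> a _; have -> : (fun d => (2 * r * u) ^+ d / d`!%:R * a ^+ d) = exp_coeff (2 * r * u * a).
    by apply/funext => d; rewrite /exp_coeff/= mulrAC -exprMn.
  exact: is_cvg_series_exp_coeff.
split => //; rewrite (_ : (fun d => _) =
    (fun d => (2 * r * u) ^+ d / d`!%:R * gmom (m + d%:R / 2) b))//.
by apply/funext => d; rewrite /radial_moment !exprMn; ring.
Qed.

Lemma radial_moment_ge0 d : 0 <= radial_moment m b r d.
Proof. by rewrite mulr_ge0 ?exprn_ge0// ltW// gmom_gt0// ltr_wpDr// divr_ge0. Qed.

Lemma normr1_le1 : `|1 : R| <= 1. Proof. by rewrite normr1. Qed.

(** At [u = 1] all terms are nonnegative and dominate those at [u]. The bound, uniform in [u], is
    the majorant for integration over the phase. *)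
Lemma envelope_partial_le u n : `|u| <= 1 ->
  `|series (fun d => radial_moment m b r d * ((2 * u) ^+ d / d`!%:R)) n| <= envelope_avg 1.
Proof.
move=> u1; have [_ c1] := envelope_avg_series normr1_le1.
apply: (@le_trans _ _ (series (fun d => radial_moment m b r d * ((2 * 1) ^+ d / d`!%:R)) n)).
  rewrite (le_trans (ler_norm_sum _ _ _))// ler_sum// => d _.
  rewrite normrM ger0_norm ?radial_moment_ge0// ler_wpM2l ?radial_moment_ge0//.
  rewrite normrM normfV normr_nat ler_wpM2r ?invr_ge0// normrX lerXn2r ?nnegrE ?mulr_ge0//.
  by rewrite normrM ger0_norm// ler_wpM2l.
rewrite -(cvg_lim _ c1)//; apply: nondecreasing_cvgn_le; last by apply/cvg_ex; eexists; exact: c1.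
apply: nondecreasing_series => d _ _.
by rewrite mulr_ge0 ?radial_moment_ge0// divr_ge0// exprn_ge0// mulr_ge0.
Qed.

(** A bound uniform in [u] survives averaging over the phase, which makes the argument of [ln]
    positive. The witness has [b + 1] because the cross term costs at most a factor
    [expR (- r ^+ 2 - a ^+ 2)]. *)
Lemma envelope_avg_gt0 : exists2 e, 0 < e & forall u, `|u| <= 1 -> e <= envelope_avg u.
Proof.
have b1 : 0 < b + 1 by rewrite addr_gt0.
exists (expR (- r ^+ 2) * gmom m (b + 1)); first by rewrite mulr_gt0 ?expR_gt0 ?gmom_gt0.
move=> u u1; have [iu _] := envelope_avg_series u1.
have ig := integrable_gmom_fun m0 b1.
have -> : (expR (- r ^+ 2) * gmom m (b + 1) =
    \int[mu]_(a in `]0%R, +oo[) (expR (- r ^+ 2) * gmom_fun m (b + 1) a))%R.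
  by rewrite RintegralZl// /Rintegral integral_gmom_fun.
apply: (@le_Rintegral _ _ R mu _ _ _ (measurable_itv _)
  (integrable_EFinZ _ (measurable_itv _) ig) iu) => a; rewrite /= in_itv/= andbT => a0.
rewrite /gmom_fun mulrCA -[leRHS]mulrA ler_wpM2l ?powR_ge0// -!expRD ler_expR.
(* 2 r u a >= - 2 r a >= - (r^2 + a^2) *)
have : - (r * a) <= r * u * a.
  rewrite mulrAC -mulrN1 ler_wpM2l ?mulr_ge0 ?(ltW a0)//.
  by move: u1; rewrite ler_norml => /andP[].
have := sqr_ge0 (r - a); rewrite sqrrB; nra.
Qed.

(* For k > 0 the frequencies k and -k are merged. *)
Definition cos_weight k : R := if k is 0%N then 1 else 2.

Lemma cos_weight_ge0 k : 0 <= cos_weight k. Proof. by case: k. Qed.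

Lemma cos_pow_sum (psi : R) d N : (d < N)%N -> (2 * cos psi) ^+ d / d`!%:R =
  \sum_(0 <= k < N) cos_weight k * bessel_coef d k * cos (k%:R * psi).
Proof.
case: N => // N dN; rewrite (@bessel_coef_cos _ psi d N)//.
rewrite big_nat_recl//= mul1r mul0r cos0 mulr1; congr (_ + _).
by rewrite mulr_sumr; apply: eq_bigr => k _; rewrite mulrA.
Qed.

Definition cos_mean k : R := cos (k%:R * (c - phi)) * expR (- (1 / 2) * sigma ^+ 2 * k%:R ^+ 2).

Lemma normr_cos_mean k : `|cos_mean k| <= 1.
Proof.
rewrite normrM (ger0_norm (expR_ge0 _)) mulr_ile1 ?expR_ge0 ?cos_max//.
rewrite expR_le1 !mulNr oppr_le0.
by rewrite mulr_ge0 ?sqr_ge0// mulr_ge0 ?sqr_ge0// mulr_ge0 ?invr_ge0.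
Qed.

Lemma integrable_normal_cos k :
  mu.-integrable setT (fun x => (normal_pdf c sigma x * cos (k * (x - phi)))%:E).
Proof.
apply: (@integrable_normal_pdfM _ c sigma _ 1); last by move=> x; exact: cos_max.
by apply: continuous_measurable_fun; exact: continuous_cosM.
Qed.

(** Expand the envelope average in [d] and integrate over the phase by dominated convergence. Each
    power of the cosine is a finite cosine sum, whose Gaussian means are known. *)
Lemma phase_avg_series :
  mu.-integrable setT (fun t => (normal_pdf c sigma t * envelope_avg (cos (t - phi)))%:E) /\
  series (fun d => radial_moment m b r d *
     \sum_(0 <= k < d.+1) cos_weight k * bessel_coef d k * cos_mean k) @ \oo -->
  (\int[mu]_t (normal_pdf c sigma t * envelope_avg (cos (t - phi))))%R.
Proof.
pose f_ n t := normal_pdf c sigma t *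
  series (fun d => radial_moment m b r d * ((2 * cos (t - phi)) ^+ d / d`!%:R)) n.
have mcos : measurable_fun setT (fun t : R => cos (t - phi)).
  apply: continuous_measurable_fun; have := @continuous_cosM R 1 phi.
  by under eq_fun do rewrite mul1r.
have [||||i ci] := @Rintegral_dominated_cvg R setT f_
  (fun t => normal_pdf c sigma t * envelope_avg (cos (t - phi)))
  (fun t => normal_pdf c sigma t * envelope_avg 1) measurableT.
- move=> n; apply: measurable_funM; first exact: measurable_normal_pdf.
  apply: measurable_sum => d; apply: measurable_funM => //.
  by apply: measurable_funM => //; apply: measurable_funX; exact: measurable_funM.
- move=> t _; apply: cvgMr.
  by have [_] := envelope_avg_series (cos_max (t - phi)).
- by apply: (@integrable_normal_pdfM _ c sigma _ `|envelope_avg 1|).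
- move=> n t _; rewrite normrM ger0_norm ?normal_pdf_ge0// ler_wpM2l ?normal_pdf_ge0//.
  exact/envelope_partial_le/cos_max.
split => //; move: ci.
suff E n : (\int[mu]_(t in setT) f_ n t)%R = series (fun d => radial_moment m b r d *
     \sum_(0 <= k < d.+1) cos_weight k * bessel_coef d k * cos_mean k) n.
  by under eq_cvg do rewrite E.
have H d : mu.-integrable setT
      (fun t => (normal_pdf c sigma t * ((2 * cos (t - phi)) ^+ d / d`!%:R))%:E) /\
    (\int[mu]_t (normal_pdf c sigma t * ((2 * cos (t - phi)) ^+ d / d`!%:R)) =
    \sum_(0 <= k < d.+1) cos_weight k * bessel_coef d k * cos_mean k)%R.
  have [i1 e1] := @Rintegral_sumZ R setT d.+1 (fun k => cos_weight k * bessel_coef d k)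
    (fun k t => normal_pdf c sigma t * cos (k%:R * (t - phi))) measurableT
    (fun k => integrable_normal_cos k%:R).
  have fE t : normal_pdf c sigma t * ((2 * cos (t - phi)) ^+ d / d`!%:R) =
      \sum_(0 <= k < d.+1) cos_weight k * bessel_coef d k *
         (normal_pdf c sigma t * cos (k%:R * (t - phi))).
    by rewrite (@cos_pow_sum _ d d.+1)// mulr_sumr; apply: eq_bigr => k _; rewrite mulrCA.
  split; first by under eq_fun do rewrite fE.
  under eq_Rintegral do rewrite fE.
  by rewrite e1; apply: eq_bigr => k _; rewrite Rintegral_normal_cos.
have [_ e2] := @Rintegral_sumZ R setT n (radial_moment m b r)
  (fun d t => normal_pdf c sigma t * ((2 * cos (t - phi)) ^+ d / d`!%:R)) measurableT
  (fun d => (H d).1).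
rewrite /series/=; under [RHS]eq_bigr do rewrite -(H _).2.
rewrite -e2; apply: eq_Rintegral => t _.
by rewrite /f_ /series/= mulr_sumr; apply: eq_bigr => d _; rewrite mulrCA.
Qed.

Lemma phase_avg_gt0 :
  (0 < \int[mu]_t (normal_pdf c sigma t * envelope_avg (cos (t - phi))))%R.
Proof.
have [e e0 he] := envelope_avg_gt0; apply: (lt_le_trans e0).
have -> : (e = \int[mu]_t (e * normal_pdf c sigma t))%R.
  rewrite RintegralZl//; last exact: integrable_normal_pdf.
  by rewrite /Rintegral integral_normal_pdf mulr1.
have [i _] := phase_avg_series.
apply: (@le_Rintegral _ _ R mu _ _ _ measurableT
  (integrable_EFinZ _ measurableT (integrable_normal_pdf c sigma)) i) => t _.
by rewrite mulrC ler_wpM2l ?normal_pdf_ge0// he// cos_max.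
Qed.

End phase_average.

(** * From the averaged series to the decision metric *)

Section main.
Context {R : realType}.
Local Notation mu := (@lebesgue_measure R).
Implicit Types (m Omega S r phi : R).

Lemma phase_var_gt0 m : 0 < phase_var m.
Proof.
rewrite /phase_var ltr_pwDl ?divr_gt0 ?exprn_gt0 ?pi_gt0//.
apply: divr_ge0; first by apply: Rintegral_ge0 => t _; rewrite mulr_ge0 ?sqr_ge0 ?powR_ge0.
by rewrite mulr_ge0 ?(mulr_ge0 _ (sqrtr_ge0 _))// /phase_const divr_ge0 ?Gamma_ge0.
Qed.

Lemma phase_std_gt0 m : 0 < phase_std m.
Proof. by rewrite sqrtr_gt0 phase_var_gt0. Qed.

Lemma cos_addn_pi (x : R) k : cos (x + k%:R * pi) = (-1) ^+ k * cos x.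
Proof.
elim: k x => [|k IH] x; first by rewrite mul0r addr0 mul1r.
rewrite -natr1 mulrDl mul1r addrA cosDpi IH exprS; ring.
Qed.

(** The sign [(-1) ^+ k.+1] comes from the mean [pi] of the phase, and the factor 2 from merging
    opposite frequencies. *)
Lemma phase_weightE m phi k :
  cos_weight k.+1 * cos_mean pi (phase_std m) phi k.+1 = phase_weight m k.+1 phi.
Proof.
rewrite /cos_mean /phase_weight sqr_sqrtr ?ltW ?phase_var_gt0//.
have -> : k.+1%:R * (pi - phi) = - (k.+1%:R * phi) + k.+1%:R * pi by ring.
by rewrite cos_addn_pi cosN /cos_weight; ring.
Qed.

(** Evaluate the cosine expansion at angle 0, where every cosine is 1; the coefficients are
    nonnegative, so truncation only decreases the sum. This supplies the majorant for the exchange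
    of sums. *)
Lemma bessel_coef_sum_le d N :
  \sum_(0 <= k < N) cos_weight k * bessel_coef d k <= 2 ^+ d / d`!%:R :> R.
Proof.
have := @cos_pow_sum R 0 d (N + d.+1) (leq_addl _ _); rewrite cos0 mulr1 => ->.
under [leRHS]eq_bigr do rewrite mulr0 cos0 mulr1.
rewrite [leRHS](@big_cat_nat _ _ _ N)//= ?leq_addr// lerDl sumr_ge0// => k _.
by rewrite mulr_ge0 ?cos_weight_ge0 ?bessel_coef_ge0.
Qed.

Lemma metric_seriesE m Omega r phi : 0 < m -> 0 < Omega -> 0 <= r ->
  metric_series m Omega r phi =
  (\int[mu]_t (normal_pdf pi (phase_std m) t *
     envelope_avg m (beta_coef m Omega) r (cos (t - phi))))%R.
Proof.
move=> m0 O0 r0; have b0 := beta_coef_gt0 m0 O0.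
set b := beta_coef m Omega in b0 *.
pose V k : R := cos_weight k * cos_mean pi (phase_std m) phi k.
have [_ cL] := phase_avg_series pi phi m0 b0 r0 (phase_std_gt0 m).
set L := (X in _ --> X) in cL; rewrite -/L.
(* The summable majorant is the envelope series at [u = 1]. *)
have cs : cvgn (series (fun d => radial_moment m b r d * (2 ^+ d / d`!%:R))).
  have [_ c1] := envelope_avg_series m0 b0 r0 (normr1_le1 (R := R)).
  by apply/cvg_ex; eexists; move: c1; rewrite mulr1; exact.
have q0 d := radial_moment_ge0 m0 b0 r0 d.
have cw k : 1 <= cos_weight k :> R by case: k => //= k; rewrite ler1n.
have cB k : series (fun d => radial_moment m b r d * bessel_coef d k) @ \oo -->
    radial_term m Omega k r.
  apply: cvg_radial_term => //; apply: series_le_cvg cs => d.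
  - by rewrite mulr_ge0 ?bessel_coef_ge0.
  - by rewrite mulr_ge0// divr_ge0// exprn_ge0.
  - rewrite ler_wpM2l// (le_trans _ (bessel_coef_sum_le d k.+1))// big_nat_recr//=.
    rewrite (@le_trans _ _ (cos_weight k * bessel_coef d k)) ?ler_peMl ?bessel_coef_ge0//.
    by rewrite lerDr sumr_ge0// => i _; rewrite mulr_ge0 ?cos_weight_ge0 ?bessel_coef_ge0.
have cF : series (fun k => V k * radial_term m Omega k r) @ \oo --> L.
  apply: (@cvg_series_exchange _ (fun k d => V k * (radial_moment m b r d * bessel_coef d k))
    (fun d => radial_moment m b r d * (2 ^+ d / d`!%:R))) => //.
  - by move=> k d dk; rewrite bessel_coef_gt// !mulr0.
  - move=> d N; apply: (@le_trans _ _ (radial_moment m b r d *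
      \sum_(0 <= k < N) cos_weight k * bessel_coef d k)).
      rewrite mulr_sumr ler_sum// => k _; rewrite mulrCA normrM ger0_norm// ler_wpM2l//.
      rewrite normrM [X in _ * X]ger0_norm ?bessel_coef_ge0// ler_wpM2r ?bessel_coef_ge0//.
      rewrite normrM ger0_norm ?cos_weight_ge0// ler_piMr ?cos_weight_ge0//.
      exact: normr_cos_mean.
    by rewrite ler_wpM2l// bessel_coef_sum_le.
  - move=> k; rewrite (_ : series _ =
       (fun n => V k * series (fun d => radial_moment m b r d * bessel_coef d k) n)).
      by apply: cvgMr; exact: cB.
    by apply/funext => n; rewrite /series/= mulr_sumr.
  - move: cL; rewrite (_ : (fun d => _ * _) = (fun d => \sum_(0 <= k < d.+1)
      V k * (radial_moment m b r d * bessel_coef d k)))//.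
    by apply/funext => d; rewrite mulr_sumr; apply: eq_bigr => k _; rewrite /V; ring.
have V0 : V 0%N = 1.
  by rewrite /V /cos_mean mul0r cos0 expr0n/= mulr0 expR0 !mulr1.
rewrite /metric_series.
suff : (fun n => \sum_(1 <= k < n) phase_weight m k phi * radial_term m Omega k r) @ \oo -->
    L - radial_term m Omega 0 r.
  by move/cvg_lim => ->//; rewrite addrC subrK.
(* Removing the [k = 0] term from the partial sum is valid only when that sum is nonempty, hence the
   shift past [n = 0]. *)
rewrite -cvg_shiftS.
rewrite (_ : (fun n => _) = (fun n => series (fun k => V k * radial_term m Omega k r) n.+1
   - radial_term m Omega 0 r)).
  by apply: cvgB; [move: cF; rewrite -cvg_shiftS|exact: cvg_cst].
apply/funext => n; rewrite /series/= [in RHS]big_nat_recl//= V0 mul1r addrAC subrr add0r.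
by rewrite big_add1/=; apply: eq_bigr => k _; rewrite -phase_weightE.
Qed.

Lemma cabs_sqr (z : R[i]) : cabs z ^+ 2 = complex.Re z ^+ 2 + complex.Im z ^+ 2.
Proof. by case: z => u v; rewrite /cabs /= sqr_sqrtr// addr_ge0 ?sqr_ge0. Qed.

Lemma cabs_ge0 (z : R[i]) : 0 <= cabs z.
Proof. by case: z => u v; rewrite /cabs /= sqrtr_ge0. Qed.

Lemma cabs_polar_sub (r phi a theta : R) :
  cabs (r%:C * cexpi phi - a%:C * cexpi theta) ^+ 2 =
  r ^+ 2 + a ^+ 2 - 2 * r * cos (theta - phi) * a.
Proof.
rewrite cabs_sqr /cexpi /= cosB.
have hphi := cos2Dsin2 phi; have hth := cos2Dsin2 theta.
transitivity (r ^+ 2 * (cos phi ^+ 2 + sin phi ^+ 2) +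
    a ^+ 2 * (cos theta ^+ 2 + sin theta ^+ 2) -
  2 * r * (cos theta * cos phi + sin theta * sin phi) * a); last by rewrite hphi hth !mulr1.
ring.
Qed.

Definition nakagami_const m Omega : R := 2 * m `^ m / (Gamma m * Omega `^ m).

Lemma nakagami_const_gt0 m Omega : 0 < m -> 0 < Omega -> 0 < nakagami_const m Omega.
Proof.
by move=> m0 O0; rewrite divr_gt0 ?mulr_gt0 ?powR_gt0 ?Gamma_gt0.
Qed.

(** The law of cosines separates [expR (- r ^+ 2)] from the phase average, which is the metric
    series. Positivity lets [ln] place that series in the exponent, so the likelihood becomes a
    decreasing function of the metric. *)
Lemma likelihood_GE m Omega S (y x : R[i]) (arg : R[i] -> R) :
    0 < m -> 0 < Omega -> is_arg arg ->
  let z := y - (Num.sqrt S)%:C * x in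
  let r := cabs z in
  likelihood_G m Omega S y x =
  (pi^-1 * nakagami_const m Omega *
    expR (- (r ^+ 2 - ln (metric_series m Omega r (arg z)))))%:E.
Proof.
move=> m0 O0 Harg z r.
have b0 := beta_coef_gt0 m0 O0; set b := beta_coef m Omega in b0.
have r0 : 0 <= r by exact: cabs_ge0.
set phi := arg z.
have [iL _] := phase_avg_series pi phi m0 b0 r0 (phase_std_gt0 m).
have L0 := phase_avg_gt0 pi phi m0 b0 r0 (phase_std_gt0 m).
rewrite opprB addrC expRD metric_seriesE//.
rewrite (@lnK R) ?posrE//.
rewrite mulrA -RintegralZl//; set A := pi^-1 * _ * _.
have iA := integrable_EFinZ A measurableT iL.
transitivity (\int[mu]_t (A * (normal_pdf pi (phase_std m) t *
    envelope_avg m b r (cos (t - phi))))%:E)%E; last first.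
  by rewrite /Rintegral fineK//; exact: integrable_fin_num iA.
apply: eq_integral => t _.
have [it _] := envelope_avg_series m0 b0 r0 (cos_max (t - phi)).
have itA := integrable_EFinZ (A * normal_pdf pi (phase_std m) t) (measurable_itv _) it.
transitivity (\int[mu]_(a in `[0%R, +oo[) (A * normal_pdf pi (phase_std m) t *
    (gmom_fun m b a * expR (2 * r * cos (t - phi) * a)))%:E)%E.
  apply: eq_integral => a _; congr (_%:E).
  rewrite -/z [z]Harg -/r -/phi cabs_polar_sub /A /nakagami_pdf /nakagami_const /gmom_fun.
  rewrite (_ : - (r ^+ 2 + a ^+ 2 - 2 * r * cos (t - phi) * a) =
    - r ^+ 2 + - a ^+ 2 + 2 * r * cos (t - phi) * a); last by ring.
  (* The rate [b] collects the Nakagami decay and the [a ^+ 2] of the noise kernel. *)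
  rewrite (_ : - (b * a ^+ 2) = - (m / Omega) * a ^+ 2 + - a ^+ 2); last first.
    by rewrite /b /beta_coef; ring.
  by rewrite !expRD; ring.
rewrite -integral_itv_obnd_cbnd; last exact: measurable_int itA.
by rewrite mulrA /envelope_avg -RintegralZl// /Rintegral fineK//; exact: integrable_fin_num itA.
Qed.

End main.

Theorem proposition1 (R : realType) (m Omega S : R)
    (C : set R[i]) (arg : R[i] -> R) :
  0 < m -> 0 < Omega -> 0 < S ->
  finite_set C -> C !=set0 -> is_arg arg ->
  forall y : R[i],
    argmax C (fun x => likelihood_G m Omega S y x) =
    argmin C (fun x =>
      let z := y - (Num.sqrt S)%:C * x in
      let r := cabs z in
      let phi := arg z in
      r ^+ 2 - ln (metric_series m Omega r phi)).
Proof.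
move=> m0 O0 _ _ _ Harg y.
have A0 : 0 < pi^-1 * nakagami_const m Omega :> R.
  by rewrite mulr_gt0 ?invr_gt0 ?pi_gt0 ?nakagami_const_gt0.
pose h x := let z := y - (Num.sqrt S)%:C * x in
  cabs z ^+ 2 - ln (metric_series m Omega (cabs z) (arg z)).
(* The positive factor does not depend on the symbol, so comparing likelihoods is comparing metrics
   in reverse order. *)
have le_h x x' : (likelihood_G m Omega S y x' <= likelihood_G m Omega S y x)%O = (h x <= h x').
  rewrite (likelihood_GE S y x m0 O0 Harg) (likelihood_GE S y x' m0 O0 Harg).
  by rewrite lee_fin (ler_pM2l A0) ler_expR lerN2.
apply/seteqP; split=> x [Cx hx]; split; [exact: Cx| |exact: Cx|] => x' Cx'.
  by move: (hx x' Cx'); rewrite le_h.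
by move: (hx x' Cx'); rewrite le_h.
Qed.
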